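(* Let $X_0,X_1$ be Banach ideal spaces on $I$ with the Fatou property and such that the Cesàro operator $C$ is bounded on $X_0$ and $X_1$. Suppose that one of the following conditions holds: (i) $I=[0,\infty)$ and the dilation operator $\sigma_\tau$ is bounded on $X_0$ and $X_1$ for some $0<\tau<1$; (ii) $I=[0,1]$ and $X_0,X_1$ are symmetric spaces with the Fatou property such that both operators $C,C^*:X_i\to X_i$ are bounded for $i=0,1$; (iii) $I=\mathbb{N}$ and the dilation operator $\sigma_3$ is bounded on the (Köthe) dual spaces $X_0'$ and $X_1'$. Then for every $\varphi\in\mathcal U$ $$\varphi(CX_0,CX_1)=C[\varphi(X_0,X_1)].$$
   Context: Let $I$ be $[0,1]$ or $[0,\infty)$ with Lebesgue measure $m$, or $\mathbb{N}$ with counting measure $m$; $L^0=L^0(I)$ is the set of equivalence classes of real-valued measurable functions on $I$. A Banach ideal space $X$ on $I$ is a Banach space $X\subset L^0(I)$ such that $f,g\in L^0$, $|f|\le|g|$ a.e., $g\in X$ imply $f\in X$ and $\|f\|_X\le\|g\|_X$; it is assumed to contain some $f$ with $f(x)>0$ for each $x\in I$. $X$ has the Fatou property if $0\le f_n\nearrow f$ a.e., $f_n\in X$ and $\sup_n\|f_n\|_X<\infty$ imply $f\in X$ and $\|f_n\|_X\nearrow\|f\|_X$. A symmetric space on $[0,1]$ is a Banach ideal space $X$ such that if $f\in X$ and $g\in L^0$ is equimeasurable with $f$ (i.e. $m(\{|f|>\lambda\})=m(\{|g|>\lambda\})$ for all $\lambda\ge0$), then $g\in X$ and $\|g\|_X=\|f\|_X$.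 The Köthe dual $X'$ is the space of $f\in L^0$ with $\|f\|_{X'}=\sup\{\int_I|fg|\,dm:\|g\|_X\le1\}<\infty$. $X=Y$ means the spaces coincide as sets with equivalent norms. For $I=[0,1]$ or $[0,\infty)$: $Cf(x)=\frac1x\int_0^xf(t)\,dt$, $C^*f(x)=\int_{I\cap[x,\infty)}\frac{f(t)}{t}\,dt$, and $\sigma_\tau f(x)=f(x/\tau)$ if $x/\tau\in I$, and $0$ otherwise. For $I=\mathbb{N}$: $C$ denotes the discrete Cesàro operator $(Ca)_n=\frac1n\sum_{k=1}^na_k$, and $\sigma_3a=(a_1,a_1,a_1,a_2,a_2,a_2,\dots)$. The abstract Cesàro space is $CX=\{f\in L^0:C|f|\in X\}$ with $\|f\|_{CX}=\|C|f|\|_X$. $\mathcal U$ is the class of functions $\varphi:\mathbb{R}_+\times\mathbb{R}_+\to\mathbb{R}_+$ that are positively homogeneous ($\varphi(\lambda s,\lambda t)=\lambda\varphi(s,t)$ for all $s,t,\lambda\ge0$) and concave on $\mathbb{R}_+\times\mathbb{R}_+$, where $\mathbb{R}_+=[0,\infty)$. The Calderón–Lozanovskiĭ space $\varphi(X_0,X_1)$ is the set of all $f\in L^0$ such that $|f|\le\lambda\varphi(|f_0|,|f_1|)$ a.e. on $I$ for some $\lambda>0$ and some $f_i\in X_i$ with $\|f_i\|_{X_i}\le1$, $i=0,1$; its norm is the infimum of such $\lambda$. *)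

(* Defs.v *)
From HB Require Import structures.
From mathcomp Require Import all_boot all_order all_algebra.
From mathcomp Require Import all_classical all_reals all_analysis.

Set Implicit Arguments.
Unset Strict Implicit.
Unset Printing Implicit Defensive.

Import Order.TTheory GRing.Theory Num.Theory.
Import numFieldNormedType.Exports.

Local Open Scope classical_set_scope.
Local Open Scope ring_scope.

(* Conventions.  The measure space I is a set D of a measurable type T together
   with a measure mu on T.  A class in L^0(I) is represented by its members: an
   element of L^0(I) is a function f : T -> R that is measurable on D, its
   values outside D being irrelevant, and functions are compared up to
   mu-almost-everywhere equality on D.  For [0,1] and [0,+oo[ the functions
   representing a class are Borel; every Lebesgue measurable function agrees
   almost everywhere with such a function, so L^0(I) is the usual one. *)

(* A set of functions with a functional, which is meaningful on the carrier
   only; no axioms. *)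
Record fun_space (T : Type) (R : realType) := FunSpace {
  carrier :> (T -> R) -> Prop ;
  fnorm : (T -> R) -> R }.

Section spaces.
Context d (T : measurableType d) (R : realType).
Variables (mu : {measure set T -> \bar R}) (D : set T).
Implicit Types (X Y : fun_space T R) (f g : T -> R).

(* The clause bis_norm0 gives definiteness in L^0; the converse, and the
   invariance of membership and norm under a.e. equality, follow from
   bis_ideal. *)
Record banach_ideal_space X : Prop := {
  bis_measurable : forall f, X f -> measurable_fun D f ;
  bis_zero : X (cst 0) ;
  bis_add : forall f g, X f -> X g -> X (f \+ g) ;
  bis_scale : forall (a : R) f, X f -> X (fun x => a * f x) ;
  bis_norm_ge0 : forall f, X f -> 0 <= fnorm X f ;
  bis_norm0 : forall f, X f -> fnorm X f = 0 ->
    {ae mu, forall x, D x -> f x = 0} ;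
  bis_normD : forall f g, X f -> X g ->
    fnorm X (f \+ g) <= fnorm X f + fnorm X g ;
  bis_normZ : forall (a : R) f, X f ->
    fnorm X (fun x => a * f x) = `|a| * fnorm X f ;
  bis_complete : forall u : nat -> T -> R, (forall n, X (u n)) ->
    (forall e : R, 0 < e -> exists N : nat, forall m n : nat,
       (N <= m)%N -> (N <= n)%N -> fnorm X (u m \- u n) < e) ->
    exists2 f, X f & (fun n => fnorm X (u n \- f)) @ \oo --> (0 : R) ;
  bis_ideal : forall f g, measurable_fun D f -> X g ->
    {ae mu, forall x, D x -> `|f x| <= `|g x|} ->
    X f /\ fnorm X f <= fnorm X g ;
  bis_unit : exists2 f, X f & forall x, D x -> 0 < f x }.

Definition fatou_property X : Prop :=
  forall (u : nat -> T -> R) f,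
    (forall n, X (u n)) -> measurable_fun D f ->
    {ae mu, forall x, D x ->
       [/\ 0 <= u 0%N x, nondecreasing_seq (u ^~ x) &
           u ^~ x @ \oo --> f x]} ->
    (exists M : R, forall n, fnorm X (u n) <= M) ->
    [/\ X f, nondecreasing_seq (fun n => fnorm X (u n)) &
        (fun n => fnorm X (u n)) @ \oo --> fnorm X f].

Definition equimeasurable f g : Prop :=
  forall l : R, 0 <= l ->
    mu [set x | D x /\ l < `|f x|] = mu [set x | D x /\ l < `|g x|].

Definition symmetric_space X : Prop :=
  banach_ideal_space X /\
  forall f g, X f -> measurable_fun D g -> equimeasurable f g ->
    X g /\ fnorm X g = fnorm X f.

Definition kothe_functional X f : \bar R :=
  ereal_sup [set (\int[mu]_(x in D) (`|f x * g x|)%:E)%E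
            | g in [set g | X g /\ fnorm X g <= 1]].

Definition kothe_dual X : fun_space T R := {|
  carrier := [set f : T -> R | measurable_fun D f /\
                      (kothe_functional X f < +oo)%E] ;
  fnorm := fun f : T -> R => fine (kothe_functional X f) |}.

(* X = Y as sets, with equivalent norms *)
Definition space_eq X Y : Prop :=
  (forall f, X f <-> Y f) /\
  exists2 c : R, 0 < c & exists2 C : R, 0 < C &
    forall f, X f -> c * fnorm X f <= fnorm Y f <= C * fnorm X f.

(* Operators take values in \bar R because the integral operators below need
   not be finite on all of L^0.  A value belongs to X when it is finite almost
   everywhere and the real function it then represents is in X.  The Lebesgue
   integral of a measurable function is a finite number exactly when the
   function is integrable, even if its sign changes, since +oo - oo = -oo in
   \bar R; finiteness thus also expresses that the operator is defined. *)
Definition ext_mem X (g : T -> \bar R) : Prop :=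
  {ae mu, forall x, D x -> g x \is a fin_num} /\ X (fine \o g).

Definition bounded_on (A : (T -> R) -> T -> \bar R) X : Prop :=
  exists M : R, forall f, X f ->
    ext_mem X (A f) /\ fnorm X (fine \o A f) <= M * fnorm X f.

(* CX, with C passed as A *)
Definition cesaro_space (A : (T -> R) -> T -> \bar R) X : fun_space T R := {|
  carrier := [set f : T -> R | measurable_fun D f /\
                      ext_mem X (A (fun x => `|f x|))] ;
  fnorm := fun f : T -> R => fnorm X (fine \o A (fun x => `|f x|)) |}.

Definition cl_bound (phi : R -> R -> R) X0 X1 f (l : R) : Prop :=
  0 < l /\
  exists f0 f1, [/\ X0 f0, fnorm X0 f0 <= 1, X1 f1, fnorm X1 f1 <= 1 &
    {ae mu, forall x, D x -> `|f x| <= l * phi `|f0 x| `|f1 x|}].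

(* The Calderon-Lozanovskii space phi(X0, X1) *)
Definition cl_space (phi : R -> R -> R) X0 X1 : fun_space T R := {|
  carrier := [set f : T -> R | measurable_fun D f /\
                      exists l, cl_bound phi X0 X1 f l] ;
  fnorm := fun f : T -> R => inf [set l | cl_bound phi X0 X1 f l] |}.

End spaces.

(* The class U; only the values on the closed quadrant matter. *)
Definition class_U (R : realType) (phi : R -> R -> R) : Prop :=
  [/\ forall s t, 0 <= s -> 0 <= t -> 0 <= phi s t,
      forall l s t, 0 <= l -> 0 <= s -> 0 <= t ->
        phi (l * s) (l * t) = l * phi s t &
      forall a s t s' t', 0 <= a <= 1 ->
        0 <= s -> 0 <= t -> 0 <= s' -> 0 <= t' ->
        a * phi s t + (1 - a) * phi s' t' <=
        phi (a * s + (1 - a) * s') (a * t + (1 - a) * t')].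

Section operators.
Context (R : realType).
Local Notation leb := (@lebesgue_measure R).

Definition cesaro_op (f : R -> R) (x : R) : \bar R :=
  ((x^-1)%:E * \int[leb]_(t in `[0%R, x]) (f t)%:E)%E.

Definition cesaro_adj_op (D : set R) (f : R -> R) (x : R) : \bar R :=
  (\int[leb]_(t in D `&` `[x, +oo[) (f t / t)%:E)%E.

Definition dilation (D : set R) (tau : R) (f : R -> R) (x : R) : \bar R :=
  (if x / tau \in D then f (x / tau) else 0)%:E.

(* Sequences are indexed by the positive integers; the value at 0 is
   irrelevant. *)
Definition cesaro_seq (a : nat -> R) (n : nat) : \bar R :=
  ((\sum_(1 <= k < n.+1) a k) / n%:R)%:E.

Definition dilation3_seq (a : nat -> R) (n : nat) : \bar R :=
  (a (n.-1 %/ 3).+1)%:E.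

End operators.

Definition unit_interval (R : realType) : set R := `[0, 1].
Definition half_line (R : realType) : set R := `[0, +oo[.
Definition pos_nat : set nat := [set n | (0 < n)%N].

(* Main.v *)
Require Import Defs.
From mathcomp Require Import all_boot all_order all_algebra.
From mathcomp Require Import all_classical all_reals all_analysis.
From mathcomp Require Import measurable_realfun ring lra zify.

Set Implicit Arguments.
Unset Strict Implicit.
Unset Printing Implicit Defensive.

Import Order.TTheory GRing.Theory Num.Theory.
Import numFieldNormedType.Exports.

Local Open Scope classical_set_scope.
Local Open Scope ring_scope.

(** Since [phi] is concave and homogeneous, Jensen's inequality for averages
    gives [C phi(|f0|, |f1|) <= phi(C|f0|, C|f1|)]; so [phi(CX0, CX1)] is
    contained in [C[phi(X0, X1)]], with an inclusion of norm at most one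
    ([class_U_jensen], [cl_bound_average]).

    Conversely let [C|f| <= l * phi(g0, g1)] with [g_i] in the unit ball of
    [X_i], and let [F(x)] be the integral of [|f|] over [[0, x]]. Cut the
    domain by points [p_k] into blocks [J_k] from [p_(k-1)] to [p_k]. For [y]
    in the next block [J_(k+1)],

      [F(p_k) <= F(y) <= l * phi(y g0(y), y g1(y))],

    and by Jensen's inequality over that block [F(p_k) <= l * phi(c0_k,
    c1_k)], where [ci_k] is the mean of [y g_i(y)] over [J_(k+1)] ([mass_le]).
    Put [f_i = |f| ci_k / F(p_k)] on [J_k] ([redistribute]). By homogeneity
    [|f| <= l * phi(f0, f1)] ([redistribute_dominates]). On the other hand
    [f_i] has integral at most [ci_k] over [J_k], whatever the local behaviour
    of [f], so that for [x] in [J_k]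

      [C f_i(x) <= (1 / x) * integral of w g_i over [0, p_(k+1)]],

    where [w(y) = y / |J_j|] on [J_j] ([average_redistribute]). It remains to
    bound this [majorant] by an element of [X_i] whose norm is controlled by
    that of [g_i]; the argument up to here is carried out for the line and for
    sequences together ([calderon_average]).

    On the half-line take [p_k = q ^ k] with [q = 1 / tau]: then [w] is
    bounded, and the majorant is at most a multiple of [(C g_i)(q^2 x)], which
    the dilation hypothesis controls ([half_line_majorant]).

    On the unit interval take the points with [p_k / (1 - p_k) = 2 ^ k], for
    which [w(y) <= 2 / (1 - y)]. Near [0] the majorant is at most a multiple
    of [C* C g_i]. Near [1] it is at most a multiple of the integral of
    [g_i(y) / (1 - y)] over [[0, p_(k+1)]], which after the measure preserving
    change of [y] into [1 - y] is a value of [C*], at a point comparable to [1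
    - x]; one more average makes up for the difference
    ([unit_interval_majorant]).

    For sequences take powers of two: the majorant at [n] is at most a
    multiple of [(C g_i)(9 n)] ([discrete_majorant]). The map that sends [b]
    to the sequence of terms [b(3 n)] is bounded on [X_i] because [sigma_3] is
    bounded on the dual: a truncated sequence is normed by an element of the
    dual, by the Hahn-Banach theorem in finite dimension, and the Fatou
    property removes the truncation ([triple_bounded]). *)

(** * Homogeneous concave functions and Jensen's inequality *)

Section class_U_theory.
Context (R : realType).
Variable phi : R -> R -> R.
Hypothesis phiU : class_U phi.

Lemma class_U_ge0 s t : 0 <= s -> 0 <= t -> 0 <= phi s t.
Proof. by case: phiU => + _ _; exact. Qed.

Lemma class_U_hom l s t : 0 <= l -> 0 <= s -> 0 <= t ->
  phi (l * s) (l * t) = l * phi s t.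
Proof. by case: phiU => _ + _; exact. Qed.

Lemma class_U_superadd s t s' t' : 0 <= s -> 0 <= t -> 0 <= s' -> 0 <= t' ->
  phi s t + phi s' t' <= phi (s + s') (t + t').
Proof.
move=> s0 t0 s0' t0'; case: phiU => _ _ cc.
have half01 : 0 <= (2^-1 : R) <= 1 by lra.
have := cc 2^-1 (2 * s) (2 * t) (2 * s') (2 * t') half01.
rewrite !class_U_hom//.
have -> : 1 - 2^-1 = 2^-1 :> R by lra.
rewrite !mulKf//; apply; lra.
Qed.

Let psi s := phi s 1.

Let psiE s t : 0 <= s -> 0 < t -> phi s t = t * psi (s / t).
Proof.
move=> s0 t0; rewrite /psi -class_U_hom ?divr_ge0 ?(ltW t0)//.
by rewrite mulr1 mulrC divfK// gt_eqF.
Qed.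

Let psi_chord u z w : 0 <= u < z -> z < w ->
  (psi w - psi z) / (w - z) <= (psi z - psi u) / (z - u).
Proof.
move=> /andP[u0 uz] zw.
rewrite ler_pdivrMr ?subr_gt0// mulrAC ler_pdivlMr ?subr_gt0//.
pose a := (w - z) / (w - u).
have wu : 0 < w - u by lra.
have a01 : 0 <= a <= 1.
  by rewrite /a divr_ge0 ?ler_pdivrMr//=; lra.
case: phiU => _ _ /(_ a u 1 w 1 a01 u0 ler01).
have -> : a * 1 + (1 - a) * 1 = 1 by lra.
have -> : a * u + (1 - a) * w = z by rewrite /a; field; lra.
rewrite -/(psi u) -/(psi w) -/(psi z).
have w0 : 0 <= w by lra.
move=> /(_ w0 ler01) h.
have := ler_wpM2r (ltW wu) h.
have -> : (a * psi u + (1 - a) * psi w) * (w - u) =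
  (w - z) * psi u + (z - u) * psi w by rewrite /a; field; lra.
lra.
Qed.

(** The slope [a] is that of a supporting line of the section [t = 1], and
    homogeneity carries the line to the open quadrant. Since [phi] may jump at
    the axes, the bound on the axis [t = 0] does not follow by continuity; it
    comes from superadditivity, which bounds [phi 1 0] by slopes of the
    section. *)
Lemma class_U_support S T : 0 < S -> 0 < T -> exists a b,
  [/\ 0 <= a, 0 <= b, phi S T = a * S + b * T &
      forall s t, 0 <= s -> 0 <= t -> phi s t <= a * s + b * t].
Proof.
move=> S0 T0; pose z := S / T.
have z0 : 0 < z by rewrite divr_gt0.
pose E := [set r | exists2 w, z < w & r = (psi w - psi z) / (w - z)].
have Ez : E (psi (z + 1) - psi z).
  by exists (z + 1); [lra | rewrite addrAC subrr add0r divr1].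
have ubE u : 0 <= u < z -> ubound E ((psi z - psi u) / (z - u)).
  by move=> uz _ [w zw ->]; exact: psi_chord.
have supE : has_sup E.
  split; first by exists (psi (z + 1) - psi z).
  by exists ((psi z - psi 0) / (z - 0)); apply: ubE; rewrite lexx.
pose a := sup E; pose b := psi z - a * z.
have line s : 0 <= s -> psi s <= a * s + b.
  move=> s0; rewrite /b; case: (ltgtP s z) => [sz|zs|->]; last by lra.
  - have := ge_sup supE.1 (ubE s _); rewrite s0 sz => /(_ isT).
    by rewrite -/a ler_pdivlMr ?subr_gt0//; lra.
  - have := sup_upper_bound supE; rewrite -/a.
    move=> /(_ ((psi s - psi z) / (s - z))).
    rewrite ler_pdivrMr ?subr_gt0// => h.
    have : psi s - psi z <= a * (s - z) by apply: h; exists s.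
    lra.
have phi10 : phi 1 0 <= a.
  apply: le_trans (sup_upper_bound supE Ez).
  have := class_U_superadd ler01 (lexx 0) (ltW z0) ler01.
  by rewrite add0r [1 + z]addrC lerBrDr.
have b0 : 0 <= b by have := line 0 (lexx _); rewrite mulr0 add0r;
  apply: le_trans; apply: class_U_ge0.
exists a, b; split => //.
- by apply: le_trans phi10; apply: class_U_ge0.
- by rewrite psiE ?(ltW S0)// -/z /b [a * z]mulrC /z; field; rewrite gt_eqF.
- move=> s t s0; rewrite le_eqVlt => /predU1P[<-|t0].
    rewrite mulr0 addr0; have := class_U_hom s0 ler01 (lexx 0).
    by rewrite mulr1 mulr0 => ->; rewrite [a * s]mulrC; apply: ler_wpM2l.
  rewrite psiE//.
  have -> : a * s + b * t = t * (a * (s / t) + b) by field; rewrite gt_eqF.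
  by apply: ler_wpM2l; [exact: ltW|apply: line; rewrite divr_ge0// (ltW t0)].
Qed.

Lemma class_U0r s : 0 <= s -> phi s 0 = s * phi 1 0.
Proof. by move=> s0; rewrite -class_U_hom// mulr1 mulr0. Qed.

Lemma class_U0l t : 0 <= t -> phi 0 t = t * phi 0 1.
Proof. by move=> t0; rewrite -class_U_hom// mulr1 mulr0. Qed.

End class_U_theory.

Section jensen.
Context d (T : measurableType d) (R : realType).
Variables (mu : {measure set T -> \bar R}).
Local Open Scope ereal_scope.

Lemma ge0_ae_eq0 (E : set T) (f : T -> R) : measurable E ->
  measurable_fun E f -> (forall x, E x -> (0 <= f x)%R) ->
  \int[mu]_(x in E) (f x)%:E = 0 -> {ae mu, forall x, E x -> f x = 0%R}.
Proof.
move=> mE mf f0 If.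
have /(ae_eq_integral_abs mu mE) : measurable_fun E (fun x => (f x)%:E).
  exact/measurable_EFinP.
rewrite (eq_integral (EFin \o f)) => [[+ _]|x /set_mem Ex]; last first.
  by rewrite /= ger0_norm// f0.
by move=> /(_ If); apply: filterS => x /[apply] -[].
Qed.

(** Jensen's inequality: integrate the linear function that supports [phi] at
    the pair of integrals. If that pair lies on an axis there may be no such
    function, but then [f0] or [f1] vanishes almost everywhere and [phi] is
    linear in the other. Bounding [f] instead of integrating [phi] itself
    avoids measurability of the composition. *)
Lemma class_U_jensen (phi : R -> R -> R) (E : set T) (l : R)
    (f f0 f1 : T -> R) : class_U phi -> measurable E -> (0 <= l)%R ->
  measurable_fun E f -> measurable_fun E f0 -> measurable_fun E f1 ->
  (forall x, E x -> 0 <= f x)%R ->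
  (forall x, E x -> 0 <= f0 x)%R -> (forall x, E x -> 0 <= f1 x)%R ->
  \int[mu]_(x in E) (f0 x)%:E < +oo -> \int[mu]_(x in E) (f1 x)%:E < +oo ->
  {ae mu, forall x, E x -> (f x <= l * phi (f0 x) (f1 x))%R} ->
  \int[mu]_(x in E) (f x)%:E <=
    (l * phi (fine (\int[mu]_(x in E) (f0 x)%:E))
             (fine (\int[mu]_(x in E) (f1 x)%:E)))%:E.
Proof.
move=> phiU mE l0 mf mf0 mf1 fge0 f0ge0 f1ge0.
set I0 := integral _ _ _; set I1 := integral _ _ _ => I0y I1y fle.
have I0_ge0 : 0 <= I0 by apply: integral_ge0 => x Ex; rewrite lee_fin f0ge0.
have I1_ge0 : 0 <= I1 by apply: integral_ge0 => x Ex; rewrite lee_fin f1ge0.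
have I0E : I0 = (fine I0)%:E by rewrite fineK// ge0_fin_numE.
have I1E : I1 = (fine I1)%:E by rewrite fineK// ge0_fin_numE.
have linear_bound a b : (0 <= a)%R -> (0 <= b)%R ->
    {ae mu, forall x, E x -> (f x <= a * f0 x + b * f1 x)%R} ->
    \int[mu]_(x in E) (f x)%:E <= (a * fine I0 + b * fine I1)%:E.
  move=> a0 b0 fab.
  apply: (@le_trans _ _
    (\int[mu]_(x in E) (a%:E * (f0 x)%:E + b%:E * (f1 x)%:E))).
    apply: ae_ge0_le_integral => //.
    - exact/measurable_EFinP.
    - move=> x Ex; rewrite -!EFinM -EFinD lee_fin.
      by rewrite addr_ge0// mulr_ge0// ?f0ge0 ?f1ge0.
    - apply: emeasurable_funD; apply: measurable_funeM;
      exact/measurable_EFinP.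
  rewrite ge0_integralD//; last 4 first.
    - by move=> x Ex; rewrite mule_ge0// lee_fin// f0ge0.
    - by apply: measurable_funeM; exact/measurable_EFinP.
    - by move=> x Ex; rewrite mule_ge0// lee_fin// f1ge0.
    - by apply: measurable_funeM; exact/measurable_EFinP.
  rewrite !ge0_integralZl_EFin//; first last.
    - exact/measurable_EFinP.
    - exact/measurable_EFinP.
  by rewrite -/I0 -/I1 I0E I1E.
have [S0|S0] := eqVneq (fine I0) 0%R.
  have f00 : {ae mu, forall x, E x -> f0 x = 0%R}.
    by apply: ge0_ae_eq0 => //; rewrite -/I0 I0E S0.
  rewrite S0 (class_U0l phiU) ?fine_ge0//.
  have := @linear_bound 0%R (l * phi 0 1)%R.
  rewrite mul0r add0r mulrA [(l * phi 0 1 * _)%R]mulrAC.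
  apply => //; first by rewrite mulr_ge0// (class_U_ge0 phiU).
  apply: filterS2 fle f00 => x + + Ex => /(_ Ex) + /(_ Ex) f0x.
  rewrite f0x (class_U0l phiU) ?f1ge0//; lra.
have [T0|T0] := eqVneq (fine I1) 0%R.
  have f10 : {ae mu, forall x, E x -> f1 x = 0%R}.
    by apply: ge0_ae_eq0 => //; rewrite -/I1 I1E T0.
  rewrite T0 (class_U0r phiU) ?fine_ge0//.
  have := @linear_bound (l * phi 1 0)%R 0%R.
  rewrite mul0r addr0 mulrA [(l * phi 1 0 * _)%R]mulrAC.
  apply => //; first by rewrite mulr_ge0// (class_U_ge0 phiU).
  apply: filterS2 fle f10 => x + + Ex => /(_ Ex) + /(_ Ex) f1x.
  rewrite f1x (class_U0r phiU) ?f0ge0//; lra.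
have {}S0 : (0 < fine I0)%R by rewrite lt_neqAle eq_sym S0 fine_ge0.
have {}T0 : (0 < fine I1)%R by rewrite lt_neqAle eq_sym T0 fine_ge0.
have [a [b [a0 b0 -> ab]]] := class_U_support phiU S0 T0.
have -> : (l * (a * fine I0 + b * fine I1) =
  (l * a) * fine I0 + (l * b) * fine I1)%R by lra.
apply: linear_bound; [exact: mulr_ge0|exact: mulr_ge0|].
apply: filterS fle => x + Ex => /(_ Ex)/le_trans; apply.
rewrite -!mulrA -mulrDr; apply: ler_wpM2l => //.
by apply: ab; [exact: f0ge0|exact: f1ge0].
Qed.

End jensen.

(** * Averaging operators *)

Section almost_everywhere_lemmas.
Context d (T : measurableType d) (R : realType).
Variable mu : {measure set T -> \bar R}.

Lemma ae_exists (D J : set T) (P : T -> Prop) : measurable J -> J `<=` D ->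
  (0 < mu J)%E -> {ae mu, forall x, D x -> P x} -> exists2 x, J x & P x.
Proof.
move=> mJ JD J0 [N [mN N0 subN]]; apply: contrapT => nP.
have JN : J `<=` N.
  move=> x Jx; apply: subN => /= DP; apply: nP; exists x => //.
  by apply: DP; exact: JD.
have : (mu J <= mu N)%E by apply: le_measure => //; rewrite inE.
by rewrite N0 leNgt J0.
Qed.

Lemma ae_forall_int (P : int -> T -> Prop) :
  (forall k, {ae mu, forall x, P k x}) -> {ae mu, forall x, forall k, P k x}.
Proof.
move=> aeP.
have := ae_foralln (fun n => aeP (Posz n)).
have := ae_foralln (fun n => aeP (Negz n)).
by apply: filterS2 => x Pn Pp [] n.
Qed.

End almost_everywhere_lemmas.

Section cesaro_frame.
Context d (T : measurableType d) (R : realType).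
Variables (mu : {measure set T -> \bar R}) (D : set T).
Variables (A : T -> set T) (v : T -> R).

Definition average (f : T -> R) (x : T) : \bar R :=
  ((v x)^-1%:E * \int[mu]_(t in A x) (f t)%:E)%E.

(** What the Cesaro operators on the line and on sequences have in common: [v
    x] is the length of the initial segment [A x]. It may vanish at points
    such as the origin, where the average is then [0]. *)
Record averaging_frame : Prop := {
  frame_measurable : measurable D ;
  frame_measurableA : forall x, D x -> measurable (A x) ;
  frame_sub : forall x, D x -> A x `<=` D ;
  frame_v_ge0 : forall x, D x -> 0 <= v x ;
  frame_measurable_v : measurable_fun D v ;
  frame_measurable_average : forall f : T -> R, measurable_fun D f ->
    (forall x, 0 <= f x) -> measurable_fun D (average f) }.

Local Notation average_abs f := (average (fun t => `|f t|%R)).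

Hypothesis fr : averaging_frame.
Let mD := frame_measurable fr.

Lemma measurable_abs (E : set T) (f : T -> R) :
  measurable_fun E f -> measurable_fun E (fun x => `|f x|).
Proof. by move=> mf; exact: measurableT_comp. Qed.

Lemma average_ge0 (f : T -> R) x : D x -> (forall t, 0 <= f t) ->
  (0 <= average f x)%E.
Proof.
move=> Dx f0; rewrite mule_ge0//.
  by rewrite lee_fin invr_ge0 (frame_v_ge0 fr).
by apply: integral_ge0 => t _; rewrite lee_fin.
Qed.

Lemma average_fin f x : 0 < v x -> average f x \is a fin_num ->
  (\int[mu]_(t in A x) (f t)%:E)%E = (v x * fine (average f x))%:E.
Proof.
move=> v0 fin; rewrite EFinM fineK// /average muleA -EFinM divff ?gt_eqF//.
by rewrite mul1e.
Qed.

(** Homogeneity of [phi] lets the factor [1 / v x] pass through Jensen's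
    inequality for integrals. *)
Lemma average_jensen (phi : R -> R -> R) (l : R) (f f0 f1 : T -> R) x :
  class_U phi -> 0 <= l -> D x ->
  measurable_fun D f -> measurable_fun D f0 -> measurable_fun D f1 ->
  {ae mu, forall x, D x -> `|f x| <= l * phi `|f0 x| `|f1 x|} ->
  average_abs f0 x \is a fin_num ->
  average_abs f1 x \is a fin_num ->
  (average_abs f x <=
   (l * phi (fine (average_abs f0 x))
            (fine (average_abs f1 x)))%:E)%E.
Proof.
move=> phiU l0 Dx mf mf0 mf1 fle fin0 fin1.
have := frame_v_ge0 fr Dx; rewrite le_eqVlt => /predU1P[v0|v0].
  rewrite {1}/average -v0 invr0 mul0e lee_fin mulr_ge0// (class_U_ge0 phiU)//.
    by rewrite fine_ge0// average_ge0.
  by rewrite fine_ge0// average_ge0.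
have sA := frame_sub fr Dx.
have mA := frame_measurableA fr Dx.
have mS (h : T -> R) : measurable_fun D h ->
    measurable_fun (A x) (fun t => `|h t|).
  by move=> mh; apply: measurable_abs; exact: measurable_funS mh.
have E0 := average_fin v0 fin0; have E1 := average_fin v0 fin1.
have : (\int[mu]_(t in A x) (`|f t|)%:E <=
   (l * phi (fine (\int[mu]_(t in A x) (`|f0 t|)%:E))
            (fine (\int[mu]_(t in A x) (`|f1 t|)%:E)))%:E)%E.
  apply: class_U_jensen => //; try exact: mS.
  - by rewrite E0 ltry.
  - by rewrite E1 ltry.
  - by apply: filterS fle => t + At; apply; exact: sA.
rewrite E0 E1 /= (class_U_hom phiU) ?(ltW v0)//; first last.
  - by rewrite fine_ge0// average_ge0.
  - by rewrite fine_ge0// average_ge0.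
have vi0 : (0 <= (v x)^-1%:E)%E by rewrite lee_fin invr_ge0 ltW.
move=> /(lee_wpmul2l vi0)/le_trans; apply.
by rewrite -EFinM lee_fin mulrCA mulKf ?gt_eqF.
Qed.

(** The easy inclusion: the pair [C|f0|], [C|f1|] witnesses that [C|f|] is in
    [phi(X0, X1)], with the constant [l] that [f0], [f1] give for [f]. *)
Lemma cl_bound_average (phi : R -> R -> R) (X0 X1 : fun_space T R)
    (f : T -> R) (l : R) : class_U phi -> measurable_fun D f ->
  cl_bound mu D phi (cesaro_space mu D average X0)
                    (cesaro_space mu D average X1) f l ->
  {ae mu, forall x, D x -> average_abs f x \is a fin_num} /\
  cl_bound mu D phi X0 X1 (fine \o average_abs f) l.
Proof.
move=> phiU mf [l0 [f0 [f1 [[mf0 [fin0 Xf0]] nf0 [mf1 [fin1 Xf1]] nf1 fle]]]].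
have key : {ae mu, forall x, D x ->
    [/\ average_abs f x \is a fin_num &
    (fine (average_abs f x) <=
     l * phi (fine (average_abs f0 x))
            (fine (average_abs f1 x)))]}.
  apply: filterS2 fin0 fin1 => x + + Dx => /(_ Dx) x0 /(_ Dx) x1.
  have := average_jensen phiU (ltW l0) Dx mf mf0 mf1 fle x0 x1.
  have a0 : (0 <= average_abs f x)%E by exact: average_ge0.
  move=> h; have fin : average_abs f x \is a fin_num.
    by rewrite ge0_fin_numE// (le_lt_trans h)// ltry.
  by split => //; rewrite -lee_fin fineK.
split; first by apply: filterS key => x + Dx => /(_ Dx)[].
split => //; exists (fine \o average_abs f0).
exists (fine \o average_abs f1); split => //.
apply: filterS key => x + Dx => /(_ Dx)[_ h] /=.
by rewrite !ger0_norm// fine_ge0// average_ge0.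
Qed.

End cesaro_frame.

(** * Redistribution along blocks *)

Section block_sets.
Variables (T : Type) (D0 : set T) (kappa : T -> int).

Definition block k := D0 `&` [set x | kappa x = k].

Definition initial k := D0 `&` [set x | kappa x <= k].

End block_sets.

Section blocks.
Context d (T : measurableType d) (R : realType).
Variables (mu : {measure set T -> \bar R}) (D : set T).
Variables (A : T -> set T) (v : T -> R).
Variables (D0 : set T) (kappa : T -> int).

Local Notation block := (block D0 kappa).
Local Notation initial := (initial D0 kappa).

(** [kappa] numbers the blocks in the order in which the sets [A x] exhaust
    the domain: on [D0], [A x] stays within the blocks up to that of [x] and
    contains all earlier ones. Blocks may be null (for sequences, those of
    negative number), but no null block follows one of positive measure, so
    that averages over the next block are always available. *)
Record block_frame : Prop := {
  block_averaging :> averaging_frame mu D A v ;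
  block_measurable0 : measurable D0 ;
  block_sub : D0 `<=` D ;
  block_ae : {ae mu, forall x, D x -> D0 x} ;
  block_v_gt0 : forall x, D0 x -> 0 < v x ;
  block_measurable : forall k, measurable (block k) ;
  block_mono : forall x y, D0 x -> D0 y -> A x y -> kappa y <= kappa x ;
  block_cover : forall x y, D0 x -> D0 y -> kappa x < kappa y -> A y x ;
  block_next : forall k, (0 < mu (block k))%E -> (0 < mu (block (k + 1)))%E ;
  block_fin : forall k, (mu (block k) < +oo)%E }.

(** With this weight the integral of [block_weight * |g|] over a block is the
    mean of [v * |g|] there. *)
Definition block_weight (t : T) : R := v t / fine (mu (block (kappa t))).

(** Bound for the averages at [x] of a redistributed function: its mass on
    each block is controlled by [g] on the following block, hence the initial
    segment that ends one block after that of [x]. *)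
Definition majorant (g : T -> R) (x : T) : \bar R :=
  ((v x)^-1%:E *
   \int[mu]_(t in initial (kappa x + 1)%R) (block_weight t * `|g t|%R)%:E)%E.

Local Notation average_abs f := (average mu A v (fun t => `|f t|%R)).

Hypothesis fr : block_frame.
Let mD : measurable D := frame_measurable fr.
Let mD0 := block_measurable0 fr.
Let sD0 := block_sub fr.

Lemma initial_bigcup k : initial k = \bigcup_n block (k - Posz n).
Proof.
apply/seteqP; split=> x.
  move=> [D0x /= xk]; exists `|k - kappa x|%N => //; split => //=.
  by rewrite gez0_abs ?subr_ge0// opprB addrC subrK.
by move=> [n _ [D0x /= E]]; split => //=; rewrite E gerBl.
Qed.

Lemma trivIset_block (s : nat -> int) : injective s ->
  trivIset setT (fun n => block (s n)).
Proof.
move=> sI i j _ _ [x [[_ /= xi] [_ /= xj]]]; apply: sI.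
by rewrite -xi -xj.
Qed.

Lemma subz_inj k : injective (fun n : nat => k - Posz n).
Proof. by move=> m n /addrI /oppr_inj []. Qed.

Lemma measurable_initial k : measurable (initial k).
Proof.
rewrite initial_bigcup; apply: bigcupT_measurable => n.
exact: block_measurable fr _.
Qed.

Lemma block_subD k : block k `<=` D.
Proof. by move=> x [/sD0]. Qed.

Lemma initial_subD k : initial k `<=` D.
Proof. by move=> x [/sD0]. Qed.

Lemma measurable_block_fun (r : int -> R) : measurable_fun D0 (r \o kappa).
Proof.
move=> _ Y mY.
have -> : D0 `&` (r \o kappa) @^-1` Y =
    (\bigcup_(n in [set n | Y (r (Posz n))]) block (Posz n)) `|`
    (\bigcup_(n in [set n | Y (r (Negz n))]) block (Negz n)).
  apply/seteqP; split=> x.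
    move=> [D0x /=]; case E : (kappa x) => [n|n] Yn; [left|right];
    by exists n.
  by move=> [] [n /= Yn [D0x /= E]]; split => //=; rewrite E.
by apply: measurableU; apply: bigcup_measurable => n _;
   exact: block_measurable fr _.
Qed.

Lemma measurable_block_weight : measurable_fun D0 block_weight.
Proof.
apply: measurable_funM.
  exact: measurable_funS (frame_measurable_v fr).
exact: (measurable_block_fun (fun k => (fine (mu (block k)))^-1)).
Qed.

Lemma measurable_weighted (g : T -> R) : measurable_fun D g ->
  measurable_fun D0 (fun t => block_weight t * `|g t|).
Proof.
move=> mg; apply: measurable_funM; first exact: measurable_block_weight.
by apply: measurable_abs; exact: measurable_funS mg.
Qed.

Lemma block_weight_ge0 t : D0 t -> 0 <= block_weight t.
Proof.
by move=> D0t; rewrite divr_ge0 ?fine_ge0// ltW// (block_v_gt0 fr).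
Qed.

Lemma weighted_ge0 (g : T -> R) t : D0 t -> 0 <= block_weight t * `|g t|.
Proof. by move=> D0t; rewrite mulr_ge0// block_weight_ge0. Qed.

Section redistribution.
Variable f : T -> R.
Hypothesis mf : measurable_fun D f.

Let mass k := (\int[mu]_(t in initial k) (`|f t|%R)%:E)%E.

Definition next_mass (g : T -> R) k : \bar R :=
  (\int[mu]_(t in block (k + 1)%R) (block_weight t * `|g t|%R)%:E)%E.

(** Dividing by the mass of [f] up to the current block, not on the block
    alone, is what makes [phi] of two redistributions dominate [f]
    ([redistribute_dominates]); as a block carries at most that mass, the
    rescaled function still has at most the mass [next_mass g k] on it. If the
    mass vanishes so does [f], and the quotient is [0]. *)
Definition redistribute (g : T -> R) : T -> R :=
  (fun t => `|f t| * (fine (next_mass g (kappa t)) / fine (mass (kappa t))))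
  \_ D0.

Lemma next_mass_ge0 g k : (0 <= next_mass g k)%E.
Proof.
by apply: integral_ge0 => t [D0t _]; rewrite lee_fin weighted_ge0.
Qed.

Lemma mass_ge0 k : (0 <= mass k)%E.
Proof. by apply: integral_ge0 => t _; rewrite lee_fin. Qed.

Lemma redistribute_ge0 g t : 0 <= redistribute g t.
Proof.
rewrite /redistribute patchE; case: ifPn => // _.
by rewrite !mulr_ge0// ?invr_ge0 fine_ge0// ?next_mass_ge0 ?mass_ge0.
Qed.

Lemma measurable_redistribute g : measurable_fun D (redistribute g).
Proof.
apply/(measurable_restrict _ mD0 mD); rewrite setIidr//.
apply: measurable_funM.
  by apply: measurable_abs; exact: measurable_funS mf.
exact: (measurable_block_fun (fun k => fine (next_mass g k) / fine (mass k))).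
Qed.

Let mS (E : set T) (h : T -> R) : measurable E -> E `<=` D ->
  measurable_fun D h -> measurable_fun E (fun t => (h t)%:E).
Proof.
by move=> mE ED mh; apply/measurable_EFinP; exact: measurable_funS mh.
Qed.

Lemma redistribute_block g k :
  ((0 < mu (block k))%E -> (next_mass g k < +oo)%E) ->
  (\int[mu]_(t in block k) (redistribute g t)%:E <= next_mass g k)%E.
Proof.
move=> finc; have mJ := block_measurable fr k.
have [J0|J0] := eqVneq (mu (block k)) 0%E.
  rewrite (eq_integral (fun t => `|(redistribute g t)%:E|%E)); last first.
    by move=> t _; rewrite gee0_abs// lee_fin redistribute_ge0.
  rewrite integral_abs_eq0 ?next_mass_ge0//.
  apply: mS => //; [exact: block_subD|exact: measurable_redistribute].
have cE : next_mass g k = (fine (next_mass g k))%:E.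
  rewrite fineK// ge0_fin_numE ?next_mass_ge0// finc//.
  by rewrite lt_neqAle eq_sym J0 measure_ge0.
set c := fine (next_mass g k) in cE; set F := fine (mass k).
have c0 : 0 <= c by rewrite fine_ge0// next_mass_ge0.
have F0 : 0 <= F by rewrite fine_ge0// mass_ge0.
have -> : (\int[mu]_(t in block k) (redistribute g t)%:E)%E =
    (\int[mu]_(t in block k) ((c / F)%R%:E * (`|f t|%R)%:E))%E.
  apply: eq_integral => t /set_mem[D0t /= tk].
  by rewrite /redistribute patchE mem_set// tk -EFinM mulrC.
rewrite ge0_integralZl_EFin//; first last.
- by rewrite divr_ge0.
- by apply: mS => //; [exact: block_subD|exact: measurable_abs].
have sub : (\int[mu]_(t in block k) (`|f t|%R)%:E <= mass k)%E.
  apply: ge0_subset_integral => //.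
  - exact: measurable_initial.
  - apply: mS; [exact: measurable_initial|exact: initial_subD|].
    exact: measurable_abs.
  - by move=> t [D0t /= tk]; split => //=; rewrite tk.
have [FE|FE] := eqVneq F 0; first by rewrite FE invr0 mulr0 mul0e next_mass_ge0.
have mE : mass k = F%:E.
  rewrite /F fineK//; move: FE; rewrite /F.
  by case: (mass k) (mass_ge0 k) => //=; rewrite eqxx.
apply: le_trans (lee_wpmul2l _ sub) _; first by rewrite lee_fin divr_ge0.
by rewrite mE -EFinM divfK// cE.
Qed.

(** Sum [redistribute_block] over the blocks up to that of [x]. *)
Lemma average_redistribute g x : measurable_fun D g ->
  (forall k, (0 < mu (block k))%E -> (next_mass g k < +oo)%E) -> D0 x ->
  (average_abs (redistribute g) x <= majorant g x)%E.
Proof.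
move=> mg finc D0x; have Dx := sD0 D0x.
rewrite /average /majorant; apply: lee_wpmul2l.
  by rewrite lee_fin invr_ge0 ltW// (block_v_gt0 fr).
have mr := measurable_redistribute g.
have -> : (\int[mu]_(t in A x) (`|redistribute g t|%R)%:E =
    \int[mu]_(t in A x `&` D0) (redistribute g t)%:E)%E.
  rewrite integral_mkcondr; apply: eq_integral => t _.
  rewrite patchE ger0_norm ?redistribute_ge0//.
  by rewrite /redistribute !patchE; case: ifPn.
apply: (@le_trans _ _
    (\int[mu]_(t in initial (kappa x)) (redistribute g t)%:E)%E).
  apply: ge0_subset_integral.
  - by apply: measurableI => //; exact: frame_measurableA fr _ Dx.
  - exact: measurable_initial.
  - by apply: mS => //; [exact: measurable_initial|exact: initial_subD].
  - by move=> t _; rewrite lee_fin redistribute_ge0.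
  - by move=> t [Axt D0t]; split => //=; exact: block_mono fr _ _ _ _ Axt.
rewrite !initial_bigcup !ge0_integral_bigcup//; first last.
- by apply: trivIset_block; exact: subz_inj.
- by move=> t _; rewrite lee_fin redistribute_ge0.
- rewrite -initial_bigcup; apply: mS => //; [exact: measurable_initial|].
  exact: initial_subD.
- by move=> n; exact: block_measurable fr _.
- by apply: trivIset_block; exact: subz_inj.
- by move=> t [n _ [D0t _]]; rewrite lee_fin weighted_ge0.
- rewrite -initial_bigcup; apply/measurable_EFinP.
  apply: measurable_funS (measurable_weighted mg) => //.
  by move=> t [].
- by move=> n; exact: block_measurable fr _.
apply: lee_nneseries => [n _ _|n _].
  by apply: integral_ge0 => t _; rewrite lee_fin redistribute_ge0.
rewrite addrAC; exact: redistribute_block (finc _).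
Qed.

(** [next_mass g k] is part of the integral in [majorant g x] for any [x] in
    the [k]-th block. *)
Lemma next_mass_fin g k : measurable_fun D g ->
  {ae mu, forall x, D0 x -> (majorant g x < +oo)%E} ->
  (0 < mu (block k))%E -> (next_mass g k < +oo)%E.
Proof.
move=> mg fin k0.
have [] := ae_exists (block_measurable fr k) (_ : block k `<=` D0) k0 fin.
  by move=> ? [].
move=> x [D0x /= xk]; rewrite /majorant xk => h.
have v0 := block_v_gt0 fr D0x.
have : (\int[mu]_(t in initial (k + 1)%R)
    (block_weight t * `|g t|%R)%:E < +oo)%E.
  move: h; set I := integral _ _ _.
  have : (0 <= I)%E.
    by apply: integral_ge0 => t [D0t _]; rewrite lee_fin weighted_ge0.
  case: I => [r _ _|_|//]; first exact: ltry.
  by rewrite mulry gtr0_sg ?invr_gt0// mul1e.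
apply: le_lt_trans; apply: ge0_subset_integral.
- exact: block_measurable fr _.
- exact: measurable_initial.
- apply/measurable_EFinP; apply: measurable_funS (measurable_weighted mg) => //.
  by move=> t [].
- by move=> t [D0t _]; rewrite lee_fin weighted_ge0.
- by move=> t [D0t /= tk]; split => //=; rewrite tk.
Qed.

End redistribution.
Lemma mass_fin (f : T -> R) k : measurable_fun D f ->
  {ae mu, forall x, D x -> average_abs f x \is a fin_num} ->
  (0 < mu (block (k + 1)))%E ->
  (\int[mu]_(t in initial k) (`|f t|%R)%:E < +oo)%E.
Proof.
move=> mf fin k1.
have := block_subD (k := k + 1).
move=> /(ae_exists (block_measurable fr (k + 1))) /(_ k1 fin) [] y
  [D0y /= yk] finy; have Dy := sD0 D0y.
have := average_fin (block_v_gt0 fr D0y) finy => E.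
apply: (@le_lt_trans _ _ (v y * fine (average_abs f y))%:E); last exact: ltry.
rewrite -E.
apply: ge0_subset_integral => //.
- exact: measurable_initial.
- exact: frame_measurableA fr _ Dy.
- apply/measurable_EFinP/measurable_abs; apply: measurable_funS mf => //.
  exact: frame_sub fr _ Dy.
- move=> t [D0t /= tk]; apply: block_cover fr _ _ D0t D0y _.
  by rewrite yk ltzD1.
Qed.

(** At every point [y] of the next block, [v y] times the average of [|f|]
    dominates the mass of [f] up to the current block. The mean over the next
    block of the resulting inequality, taken with Jensen's inequality, turns
    the values of [g0], [g1] at [y] into quantities that depend on [k] only. *)
Lemma mass_le (phi : R -> R -> R) (l : R) (f g0 g1 : T -> R) k :
  class_U phi -> 0 <= l -> measurable_fun D f ->
  measurable_fun D g0 -> measurable_fun D g1 ->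
  {ae mu, forall x, D x -> average_abs f x \is a fin_num} ->
  {ae mu, forall x, D x ->
    `|fine (average_abs f x)| <= l * phi `|g0 x| `|g1 x|} ->
  (0 < mu (block (k + 1)))%E ->
  (next_mass g0 k < +oo)%E -> (next_mass g1 k < +oo)%E ->
  fine (\int[mu]_(t in initial k) (`|f t|%R)%:E)%E <=
    l * phi (fine (next_mass g0 k)) (fine (next_mass g1 k)).
Proof.
move=> phiU l0 mf mg0 mg1 fin fle k1 fin0 fin1.
have Fy := mass_fin mf fin k1.
set M := integral _ _ _ in Fy *.
have M0 : (0 <= M)%E by apply: integral_ge0 => t _; rewrite lee_fin.
have ME : M = (fine M)%:E by rewrite fineK// ge0_fin_numE.
have mJ := block_measurable fr (k + 1).
pose m := fine (mu (block (k + 1))).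
have mE : mu (block (k + 1)) = m%:E.
  by rewrite fineK// ge0_fin_numE ?(block_fin fr).
have m0 : 0 < m by move: k1; rewrite mE lte_fin.
have sub : block (k + 1) `<=` D0 by move=> ? [].
have jensen : (\int[mu]_(t in block (k + 1)%R) (fine M / m)%:E <=
    (l * phi (fine (next_mass g0 k)) (fine (next_mass g1 k)))%:E)%E.
  apply: class_U_jensen => //.
  - exact: measurable_funS (measurable_weighted mg0).
  - exact: measurable_funS (measurable_weighted mg1).
  - by move=> t _; rewrite divr_ge0 ?fine_ge0// ltW.
  - by move=> t [D0t _]; exact: weighted_ge0.
  - by move=> t [D0t _]; exact: weighted_ge0.
  apply: filterS2 fin fle => y + + [D0y /= yk]; have Dy := sD0 D0y.
  move=> /(_ Dy) finy /(_ Dy) ley; have v0 := block_v_gt0 fr D0y.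
  have wE (g : T -> R) : block_weight y * `|g y| = m^-1 * (v y * `|g y|).
    by rewrite /block_weight yk -/m mulrAC mulrC.
  rewrite !wE !(class_U_hom phiU) ?mulr_ge0 ?invr_ge0 ?(ltW m0) ?(ltW v0)//.
  rewrite [fine M / m]mulrC [l * _]mulrCA.
  apply: ler_wpM2l; first by rewrite invr_ge0 ltW.
  rewrite mulrCA.
  apply: le_trans (ler_wpM2l (ltW v0) (le_trans (ler_norm _) ley)).
  rewrite -lee_fin -ME -average_fin//.
  apply: ge0_subset_integral => //.
  - exact: measurable_initial.
  - exact: frame_measurableA fr _ Dy.
  - apply/measurable_EFinP/measurable_abs; apply: measurable_funS mf => //.
    exact: frame_sub fr _ Dy.
  - move=> t [D0t /= tk]; apply: block_cover fr _ _ D0t D0y _.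
    by rewrite yk ltzD1.
move: jensen; rewrite integral_cst// mE -EFinM divfK ?gt_eqF//.
Qed.

(** Multiply [mass_le] by the quotient of [|f|] and the mass, and use
    homogeneity of [phi]. *)
Lemma redistribute_dominates (phi : R -> R -> R) (l : R) (f g0 g1 : T -> R) :
  class_U phi -> 0 <= l -> measurable_fun D f ->
  measurable_fun D g0 -> measurable_fun D g1 ->
  {ae mu, forall x, D x -> average_abs f x \is a fin_num} ->
  {ae mu, forall x, D x ->
    `|fine (average_abs f x)| <= l * phi `|g0 x| `|g1 x|} ->
  (forall k, (0 < mu (block k))%E -> (next_mass g0 k < +oo)%E) ->
  (forall k, (0 < mu (block k))%E -> (next_mass g1 k < +oo)%E) ->
  {ae mu, forall x, D x ->
    `|f x| <= l * phi `|redistribute f g0 x| `|redistribute f g1 x|}.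
Proof.
move=> phiU l0 mf mg0 mg1 fin fle fin0 fin1.
suff : {ae mu, forall x, forall k, block k x ->
    `|f x| <= l * phi `|redistribute f g0 x| `|redistribute f g1 x|}.
  apply: filterS2 (block_ae fr) => x DD0 + Dx; apply.
  by split => //; exact: DD0.
apply: ae_forall_int => k.
have [k0|k0] := eqVneq (mu (block k)) 0%E.
  exists (block k); split => //; first exact: block_measurable fr _.
  by move=> t /= /not_implyP[].
have {}k0 : (0 < mu (block k))%E by rewrite lt_neqAle eq_sym k0 measure_ge0.
have k1 := block_next fr k0.
have := mass_le phiU l0 mf mg0 mg1 fin fle k1 (fin0 _ k0) (fin1 _ k0).
have := mass_fin mf fin k1.
set M := integral _ _ _ => My Mle.
have M0 : (0 <= M)%E by apply: integral_ge0 => t _; rewrite lee_fin.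
have rE g t : block k t -> redistribute f g t =
    `|f t| / fine M * fine (next_mass g k).
  move=> [D0t /= tk]; rewrite /redistribute patchE mem_set// tk.
  by rewrite mulrA mulrAC.
have [FM|FM] := eqVneq (fine M) 0.
  have : {ae mu, forall t, initial k t -> `|f t| = 0}.
    apply: ge0_ae_eq0 => //; first exact: measurable_initial.
      apply: measurable_abs; apply: measurable_funS mf => //.
      exact: initial_subD.
    by rewrite -/M -[M]fineK ?FM// ge0_fin_numE.
  apply: filterS => t + [D0t /= tk] => ->; last by split => //=; rewrite tk.
  by rewrite mulr_ge0// (class_U_ge0 phiU).
have F0 : 0 < fine M by rewrite lt_neqAle eq_sym FM fine_ge0.
apply: aeW => t kt; rewrite !(ger0_norm (redistribute_ge0 _ _ _)) !rE//.
rewrite (class_U_hom phiU) ?divr_ge0 ?(ltW F0) ?fine_ge0 ?next_mass_ge0//.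
rewrite mulrCA mulrAC ler_pdivlMr// mulrC.
have := ler_wpM2l (normr_ge0 (f t)) Mle.
by rewrite mulrC.
Qed.

(** Boundedness of [majorant] on [X], stated by domination because a majorant
    may be infinite at some points. *)
Definition majorant_bounded (X : fun_space T R) := exists2 K : R, 0 < K &
  forall g, X g -> exists G, [/\ X G, fnorm X G <= K * fnorm X g &
    {ae mu, forall x, D0 x -> (majorant g x <= (`|G x|%R)%:E)%E}].

Lemma redistribute_mem (X : fun_space T R) (f g G : T -> R) :
  banach_ideal_space mu D X -> measurable_fun D f -> measurable_fun D g ->
  (forall k, (0 < mu (block k))%E -> (next_mass g k < +oo)%E) ->
  X G -> {ae mu, forall x, D0 x -> (majorant g x <= (`|G x|%R)%:E)%E} ->
  cesaro_space mu D (average mu A v) X (redistribute f g) /\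
  fnorm (cesaro_space mu D (average mu A v) X) (redistribute f g) <= fnorm X G.
Proof.
move=> bX mf mg fing XG gG.
have mr := measurable_redistribute mf g.
have leG : {ae mu, forall x, D x ->
    (average_abs (redistribute f g) x <= (`|G x|%R)%:E)%E}.
  apply: filterS2 gG (block_ae fr) => x + + Dx => + /(_ Dx) D0x => /(_ D0x).
  by apply: le_trans; exact: average_redistribute.
have avg0 x : D x -> (0 <= average_abs (redistribute f g) x)%E.
  by move=> Dx; exact: average_ge0 fr _ _ Dx _.
have fin : {ae mu, forall x, D x ->
    average_abs (redistribute f g) x \is a fin_num}.
  apply: filterS leG => x + Dx => /(_ Dx) h.
  by rewrite ge0_fin_numE ?avg0// (le_lt_trans h)// ltry.
have [] := @bis_ideal _ _ _ _ _ _ bX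
    (fine \o average_abs (redistribute f g)) G _ XG.
- apply: measurableT_comp => //.
  by apply: (frame_measurable_average fr) => //; exact: measurable_abs.
- apply: filterS2 fin leG => x + + Dx => /(_ Dx) finx /(_ Dx) leGx.
  by rewrite /= [leLHS]ger0_norm ?fine_ge0 ?avg0// -lee_fin fineK.
by move=> Xr nr; split.
Qed.

Lemma cl_bound_redistribute (phi : R -> R -> R) (X0 X1 : fun_space T R) :
  class_U phi ->
  banach_ideal_space mu D X0 -> banach_ideal_space mu D X1 ->
  majorant_bounded X0 -> majorant_bounded X1 ->
  exists2 K : R, 0 < K & forall (f : T -> R) l, measurable_fun D f ->
    {ae mu, forall x, D x -> average_abs f x \is a fin_num} ->
    cl_bound mu D phi X0 X1 (fine \o average_abs f) l ->
    cl_bound mu D phi (cesaro_space mu D (average mu A v) X0)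
                      (cesaro_space mu D (average mu A v) X1) f (K * l).
Proof.
move=> phiU b0 b1 [K0 K0gt0 maj0] [K1 K1gt0 maj1].
pose K := Num.max K0 K1.
have K0K : K0 <= K by rewrite le_max lexx.
have K1K : K1 <= K by rewrite le_max lexx orbT.
have K_gt0 : 0 < K by exact: lt_le_trans K0K.
exists K => // f l mf fin [l0 [g0 [g1 [Xg0 ng0 Xg1 ng1 fle]]]].
(* Dividing the bounding functions by [K] puts the redistributed ones in the
   unit balls. *)
have shrink (X : fun_space T R) Ki g : banach_ideal_space mu D X ->
    0 < Ki -> Ki <= K -> (forall g, X g -> exists G, [/\ X G,
      fnorm X G <= Ki * fnorm X g &
      {ae mu, forall x, D0 x -> (majorant g x <= (`|G x|%R)%:E)%E}]) ->
    X g -> fnorm X g <= 1 ->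
    let h x := K^-1 * g x in
    [/\ measurable_fun D h,
        forall k, (0 < mu (block k))%E -> (next_mass h k < +oo)%E,
        cesaro_space mu D (average mu A v) X (redistribute f h) &
        fnorm (cesaro_space mu D (average mu A v) X) (redistribute f h) <= 1].
  move=> bX Ki0 KiK maj Xg ng h.
  have Xh : X h by exact: bis_scale bX _ _ Xg.
  have nh : fnorm X h <= K^-1.
    rewrite (bis_normZ bX)// ger0_norm ?invr_ge0 ?(ltW K_gt0)//.
    by rewrite ler_piMr// invr_ge0 ltW.
  have mh : measurable_fun D h by exact: bis_measurable bX _ Xh.
  have [G [XG nG hG]] := maj _ Xh.
  have finh k : (0 < mu (block k))%E -> (next_mass h k < +oo)%E.
    apply: next_mass_fin => //; apply: filterS hG => x + D0x => /(_ D0x).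
    by move/le_lt_trans; apply; exact: ltry.
  have [mem nmem] := redistribute_mem bX mf mh finh XG hG.
  split => //; apply: le_trans nmem _; apply: le_trans nG _.
  apply: le_trans (ler_wpM2l (ltW Ki0) nh) _.
  by rewrite ler_pdivrMr// mul1r.
have [mh0 finh0 mem0 nmem0] := shrink _ _ _ b0 K0gt0 K0K maj0 Xg0 ng0.
have [mh1 finh1 mem1 nmem1] := shrink _ _ _ b1 K1gt0 K1K maj1 Xg1 ng1.
split; first exact: mulr_gt0.
exists (redistribute f (fun x => K^-1 * g0 x)).
exists (redistribute f (fun x => K^-1 * g1 x)); split => //.
apply: redistribute_dominates => //; first by rewrite mulr_ge0// ltW.
apply: filterS fle => x + Dx => /(_ Dx)/le_trans; apply.
rewrite !normrM (ger0_norm (_ : 0 <= K^-1)) ?invr_ge0 ?(ltW K_gt0)//.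
rewrite (class_U_hom phiU) ?invr_ge0 ?(ltW K_gt0)//.
by rewrite [K * l]mulrC -mulrA mulVKf// gt_eqF.
Qed.

(** Both inclusions transform the admissible constants of [cl_bound]
    explicitly (by the factors [1] and [K]), which gives the equivalence of
    the norms. *)
Theorem calderon_average (phi : R -> R -> R) (X0 X1 : fun_space T R) :
  class_U phi ->
  banach_ideal_space mu D X0 -> banach_ideal_space mu D X1 ->
  majorant_bounded X0 -> majorant_bounded X1 ->
  space_eq (cl_space mu D phi (cesaro_space mu D (average mu A v) X0)
                              (cesaro_space mu D (average mu A v) X1))
           (cesaro_space mu D (average mu A v) (cl_space mu D phi X0 X1)).
Proof.
move=> phiU b0 b1 maj0 maj1.
have [K K0 back] := cl_bound_redistribute phiU b0 b1 maj0 maj1.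
have mavg (f : T -> R) : measurable_fun D f ->
    measurable_fun D (fine \o average_abs f).
  move=> mf; apply: measurableT_comp => //.
  by apply: (frame_measurable_average fr) => //; exact: measurable_abs.
split.
  move=> f; split => [[mf [l fl]]|[mf [fin [_ [l fl]]]]].
    have [fin fl'] := cl_bound_average fr phiU mf fl.
    by split => //; split => //; split; [exact: mavg|exists l].
  by split => //; exists (K * l); exact: back.
exists K^-1; first by rewrite invr_gt0.
exists 1 => // f [mf [l fl]]; rewrite mul1r /=.
set S1 := [set l | _]; set S2 := [set l | _].
have S1S2 : S1 `<=` S2 by move=> r /(cl_bound_average fr phiU mf)[].
have fin : {ae mu, forall x, D x -> average_abs f x \is a fin_num}.
  by have [] := cl_bound_average fr phiU mf fl.
have lb1 : has_lbound S1 by exists 0 => r [/ltW].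
have lb2 : has_lbound S2 by exists 0 => r [/ltW].
have ne1 : S1 !=set0 by exists l.
have ne2 : S2 !=set0 by exists l; exact: S1S2.
apply/andP; split.
  rewrite ler_pdivrMl//; rewrite -ler_pdivrMl//.
  apply: lb_le_inf => // r S2r; rewrite ler_pdivrMl//.
  by apply: ge_inf => //; exact: back.
by apply: lb_le_inf => // r S1r; apply: ge_inf => //; exact: S1S2.
Qed.

End blocks.

(** * Blocks on the real line *)

Section real_line.
Context (R : realType).
Local Notation leb :=
  (@lebesgue_measure R : {measure set (measurableTypeR R) -> \bar R}).
Local Notation upto := (fun x : R => `[0, x]%classic).

Lemma leb_itv (b0 b1 : bool) (a b : R) : a < b ->
  leb [set` Interval (BSide b0 a) (BSide b1 b)] = (b - a)%:E.
Proof.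
move=> ab; transitivity (@lebesgue_measure R
  ([set` Interval (BSide b0 a) (BSide b1 b)] : set R)); first by [].
by rewrite lebesgue_measure_itv/= lte_fin ab EFinB.
Qed.

Lemma leb_set1 (a : R) : leb [set a] = 0%E.
Proof. exact: lebesgue_measure_set1. Qed.

Lemma measurable_fun_inv (D : set R) : D `<=` `[0, +oo[ ->
  measurable_fun D (fun x : R => x^-1).
Proof.
move=> D0 mD.
apply: (eq_measurable_fun (fun x : R => powR x (-1))) => //.
  by move=> x /set_mem/D0; rewrite /= in_itv/= andbT => /powR_inv1.
by apply: measurable_funTS; exact: measurable_powR.
Qed.

Lemma nondecreasing_emeasurable (D : set R) (F : R -> \bar R) :
  is_interval D -> (forall x y, D x -> D y -> x <= y -> (F x <= F y)%E) ->
  measurable_fun D F.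
Proof.
move=> iD F_nd mD.
apply: (measurability _ (ErealGenOInfty.measurableE R)) => //.
move=> /= _ [_ [a ->] <-]; apply: is_interval_measurable.
move=> x y [Dx /=]; rewrite in_itv/= andbT => ax [Dy _] z /andP[xz zy].
have Dz : D z by apply: (iD x y) => //; rewrite xz.
by split => //=; rewrite in_itv/= andbT (lt_le_trans ax)// F_nd.
Qed.

Record initial_interval (D : set R) : Prop := {
  initial_is_interval : is_interval D ;
  initial_ge0 : D `<=` `[0, +oo[ ;
  initial_upto : forall x, D x -> `[0, x] `<=` D }.

Lemma real_averaging_frame (D : set R) : initial_interval D ->
  averaging_frame leb D upto id.
Proof.
move=> [iD D0 sD].
have mD : measurable D by exact: is_interval_measurable.
split => //.
- by move=> x /D0; rewrite /= in_itv/= andbT.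
- move=> f mf f0; apply: emeasurable_funM.
    by apply/measurable_EFinP; exact: measurable_fun_inv.
  apply: nondecreasing_emeasurable => // x y Dx Dy xy.
  apply: ge0_subset_integral => //.
  + by apply/measurable_EFinP; apply: measurable_funS mf => //; exact: sD.
  + by move=> t _; rewrite lee_fin.
  + by move=> t; rewrite /= !in_itv/= => /andP[-> /le_trans ->].
Qed.

(** The field [real_blocksP] says that the blocks are the intervals from [p (k
    - 1)], excluded, to [p k], included. *)
Record real_blocks (D D0 : set R) (kappa : R -> int) (p : int -> R) : Prop := {
  real_blocks_initial : initial_interval D ;
  real_blocks_interval : is_interval D0 ;
  real_blocks_sub : D0 `<=` D ;
  real_blocks_ae : {ae leb, forall x, D x -> D0 x} ;
  real_blocks_gt0 : forall x, D0 x -> 0 < x ;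
  real_blocksP : forall x (k : int), D0 x -> (kappa x <= k) = (x <= p k) ;
  real_blocks_point : forall k, D0 (p k) ;
  real_blocks_lt : forall k : int, p (k - 1) < p k }.

Section real_block_theory.
Variables (D D0 : set R) (kappa : R -> int) (p : int -> R).
Hypothesis rb : real_blocks D D0 kappa p.
Let iD := real_blocks_initial rb.
Let iD0 := real_blocks_interval rb.
Let sub := real_blocks_sub rb.
Let aeD0 := real_blocks_ae rb.
Let D0_gt0 := real_blocks_gt0 rb.
Let kappaP := real_blocksP rb.
Let D0p := real_blocks_point rb.
Let p_lt := real_blocks_lt rb.

Lemma kappa_gt x : D0 x -> p (kappa x - 1) < x.
Proof. by move=> D0x; rewrite ltNge -kappaP// -ltNge ltrBlDr ltzD1. Qed.

Lemma real_block k : block D0 kappa k = `]p (k - 1), p k]%classic.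
Proof.
apply/seteqP; split=> x.
  move=> [D0x /= <-]; rewrite in_itv/= kappa_gt//=.
  by rewrite -kappaP.
rewrite /= in_itv/= => /andP[px xp].
have D0x : D0 x by apply: (iD0 (D0p (k - 1)) (D0p k)); rewrite (ltW px).
split => //=; apply/eqP; rewrite eq_le kappaP// xp/=.
by move: px; rewrite ltNge -kappaP// -ltNge ltrBlDr ltzD1.
Qed.

Lemma real_block_measure k : leb (block D0 kappa k) = (p k - p (k - 1))%:E.
Proof. by rewrite real_block leb_itv. Qed.

Lemma real_block_frame : block_frame leb D upto id D0 kappa.
Proof.
split => //.
- exact: real_averaging_frame.
- exact: is_interval_measurable.
- by move=> k; rewrite real_block.
- move=> x y D0x D0y; rewrite /= in_itv/= => /andP[_ yx].
  by rewrite kappaP// (le_trans yx)// -kappaP.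
- move=> x y D0x D0y xy; rewrite /= in_itv/= ltW ?D0_gt0//=.
  rewrite leNgt; apply/negP => yx; move: xy; rewrite ltNge => /negP; apply.
  by rewrite kappaP// (le_trans (ltW yx))// -kappaP.
- by move=> k _; rewrite real_block_measure lte_fin subr_gt0 p_lt.
- by move=> k; rewrite real_block_measure ltry.
Qed.

Lemma real_block_weight t : D0 t ->
  block_weight leb id D0 kappa t = t / (p (kappa t) - p (kappa t - 1)).
Proof. by move=> _; rewrite /block_weight real_block_measure. Qed.

(** A pointwise bound [w] of the weight reduces the majorant to an integral
    over an interval, which can be compared with the values of concrete
    operators. *)
Lemma majorant_le (w g : R -> R) x : measurable_fun D g -> D0 x ->
  measurable_fun `[0, p (kappa x + 1)] w ->
  (forall t, D0 t -> t <= p (kappa x + 1) ->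
     block_weight leb id D0 kappa t <= w t) ->
  (forall t, 0 <= t <= p (kappa x + 1) -> 0 <= w t) ->
  (majorant leb id D0 kappa g x <=
   x^-1%:E * \int[leb]_(t in `[0%R, p (kappa x + 1)%R]) (w t * `|g t|%R)%:E)%E.
Proof.
move=> mg D0x mw lew w0; apply: lee_wpmul2l.
  by rewrite lee_fin invr_ge0 ltW// D0_gt0.
have fr := real_block_frame.
set q := p (kappa x + 1) in mw lew w0 *.
have sI : initial D0 kappa (kappa x + 1) `<=` `[0, q].
  move=> t [D0t /=]; rewrite kappaP// in_itv/= => ->.
  by rewrite andbT ltW// D0_gt0.
have mI := measurable_initial fr (kappa x + 1).
have sq : `[0, q] `<=` D := initial_upto iD (sub (D0p (kappa x + 1))).
have mwg : measurable_fun `[0, q] (fun t => (w t * `|g t|)%:E).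
  apply/measurable_EFinP; apply: measurable_funM => //.
  by apply: measurable_abs; apply: measurable_funS mg => //;
     apply: is_interval_measurable; exact: initial_is_interval iD.
apply: (@le_trans _ _ (\int[leb]_(t in initial D0 kappa (kappa x + 1)%R)
    (w t * `|g t|%R)%:E)%E).
  apply: ge0_le_integral => //.
  - by move=> t [D0t _]; rewrite lee_fin (weighted_ge0 fr).
  - apply/measurable_EFinP; apply: measurable_funS (measurable_weighted fr mg).
      exact: is_interval_measurable.
    by move=> t [].
  - by apply: measurable_funS mwg.
  - move=> t It; rewrite lee_fin ler_wpM2r// lew//; first by case: It.
    by have := sI _ It; rewrite /= in_itv/= => /andP[].
apply: ge0_subset_integral => //.
by move=> t; rewrite /= in_itv/= => h; rewrite lee_fin mulr_ge0// w0.
Qed.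

End real_block_theory.

Lemma cesaro_op_ge0 (f : R -> R) x : 0 <= x -> (forall t, 0 <= f t) ->
  (0 <= cesaro_op f x)%E.
Proof.
move=> x0 f0; rewrite mule_ge0 ?lee_fin ?invr_ge0//.
by apply: integral_ge0 => t _; rewrite lee_fin.
Qed.

Lemma bounded_on_gt0 d (T : measurableType d) (mu : {measure set T -> \bar R})
    (D : set T) (X : fun_space T R) (B : (T -> R) -> T -> \bar R) :
  banach_ideal_space mu D X -> bounded_on mu D B X ->
  exists2 M : R, 0 < M & forall f, X f -> ext_mem mu D X (B f) /\
    fnorm X (fine \o B f) <= M * fnorm X f.
Proof.
move=> bX [M BM]; exists (`|M| + 1); first by rewrite ltr_wpDl.
move=> f Xf; have [? h] := BM _ Xf; split => //.
apply: le_trans h _; apply: ler_wpM2r; first exact: bis_norm_ge0 bX _ Xf.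
by rewrite (le_trans (ler_norm _))// lerDl.
Qed.

Lemma bis_abs d (T : measurableType d) (mu : {measure set T -> \bar R})
    (D : set T) (X : fun_space T R) (f : T -> R) :
  banach_ideal_space mu D X -> X f ->
  X (fun x => `|f x|) /\ fnorm X (fun x => `|f x|) <= fnorm X f.
Proof.
move=> bX Xf; apply: (bis_ideal bX) => //.
  by apply: measurable_abs; exact: bis_measurable bX _ Xf.
by apply: aeW => x _; rewrite normr_id.
Qed.

(** The integral over [[0, x]] increases with [x]: if the averages are finite
    almost everywhere, it is finite everywhere but possibly at the right end
    point of the domain. *)
Lemma upto_integral_fin (D : set R) (f : R -> R) x y : initial_interval D ->
  measurable_fun D f -> (forall t, 0 <= f t) ->
  {ae leb, forall x, D x -> average leb upto id f x \is a fin_num} ->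
  0 < x < y -> D y -> (\int[leb]_(t in `[0%R, x]) (f t)%:E < +oo)%E.
Proof.
move=> iD mf f0 fin /andP[x0 xy] Dy.
have Dxy : `[x, y] `<=` D.
  move=> t; rewrite /= in_itv/= => /andP[xt ty].
  apply: (initial_upto iD Dy); rewrite /= in_itv/= ty andbT.
  by rewrite (le_trans (ltW x0)).
have pos : (0 < leb `[x, y]%classic)%E.
  by rewrite leb_itv// lte_fin subr_gt0.
have [z] := ae_exists (mu := leb) (measurable_itv `[x, y]) Dxy pos fin.
rewrite /= in_itv/= => /andP[xz zy] finz.
have z0 : 0 < z by exact: lt_le_trans xz.
apply: (@le_lt_trans _ _ (z * fine (average leb upto id f z))%:E);
  last exact: ltry.
have <- : (\int[leb]_(t in `[0%R, z]) (f t)%:E)%E =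
    (z * fine (average leb upto id f z))%:E by exact: average_fin z0 finz.
apply: ge0_subset_integral => //.
- apply/measurable_EFinP; apply: measurable_funS mf.
    by apply: is_interval_measurable; exact: initial_is_interval iD.
  by apply: (initial_upto iD); apply: Dxy; rewrite /= in_itv/= xz.
- by move=> t _; rewrite lee_fin.
- by move=> t; rewrite /= !in_itv/= => /andP[-> /le_trans ->].
Qed.

End real_line.

(** * The half-line *)

Section geometric_points.
Context (R : realType) (q : R).
Hypothesis q1 : 1 < q.

Definition geom (k : int) : R := expR (k%:~R * ln q).

Definition geom_index (x : R) : int := Num.ceil (ln x / ln q).

Let q0 : 0 < q. Proof. exact: lt_trans q1. Qed.

Lemma geom_gt0 k : 0 < geom k. Proof. exact: expR_gt0. Qed.

Lemma geom0 : geom 0 = 1. Proof. by rewrite /geom mul0r expR0. Qed.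

Lemma geomD1 k : geom (k + 1) = q * geom k.
Proof. by rewrite /geom intrD mulrDl mul1r expRD mulrC lnK// posrE. Qed.

Lemma geomB1 k : geom k = q * geom (k - 1).
Proof. by rewrite -geomD1 subrK. Qed.

Lemma geom_lt k : geom (k - 1) < geom k.
Proof. by rewrite [ltRHS]geomB1 ltr_pMl// geom_gt0. Qed.

Lemma le_geom j k : j <= k -> geom j <= geom k.
Proof.
by move=> jk; rewrite ler_expR ler_wpM2r ?ler_int// ln_ge0// ltW.
Qed.

Lemma geom_indexP x k : 0 < x -> (geom_index x <= k) = (x <= geom k).
Proof.
move=> x0; rewrite /geom_index ceil_le_int ler_pdivrMr ?ln_gt0//.
by rewrite -{2}(lnK (_ : x \in Num.pos)) ?posrE// ler_expR.
Qed.

End geometric_points.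

Section half_line.
Context (R : realType).
Local Notation leb :=
  (@lebesgue_measure R : {measure set (measurableTypeR R) -> \bar R}).
Local Notation upto := (fun x : R => `[0, x]%classic).
Local Notation I := (@half_line R).

Lemma half_line_initial : initial_interval I.
Proof.
split => //; first exact: interval_is_interval.
by move=> x _ t; rewrite /half_line /= !in_itv/= => /andP[->].
Qed.

Let I0 : set R := `]0, +oo[%classic.

Lemma half_line_blocks (q : R) : 1 < q ->
  real_blocks I I0 (geom_index q) (geom q).
Proof.
move=> q1; split.
- exact: half_line_initial.
- exact: interval_is_interval.
- by move=> x; rewrite /I0 /half_line /= !in_itv/= !andbT => /ltW.
- exists [set (0 : R)]; split; [by []|exact: leb_set1|].
  move=> x /=; rewrite /I0 /half_line /= !in_itv/= !andbT.
  move=> /not_implyP[x0 /negP]; rewrite -leNgt => x0'.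
  by apply: le_anti; rewrite x0 x0'.
- by move=> x; rewrite /I0 /= in_itv/= andbT.
- by move=> x k; rewrite /I0 /= in_itv/= andbT => x0; exact: geom_indexP.
- by move=> k; rewrite /I0 /= in_itv/= andbT geom_gt0.
- by move=> k; exact: geom_lt.
Qed.

(** With ratio [q = 1 / tau] the weight is at most [q / (q - 1)], and the
    block after that of [x] ends below [q ^+ 2 * x]. So the majorant is at
    most a multiple of the average of [|g|] at [q ^+ 2 * x], that is, of two
    dilations of the average. *)
Lemma half_line_majorant (X : fun_space R R) (tau : R) :
  banach_ideal_space leb I X -> bounded_on leb I (@cesaro_op R) X ->
  0 < tau < 1 -> bounded_on leb I (dilation I tau) X ->
  majorant_bounded leb id I0 (geom_index tau^-1) X.
Proof.
move=> bX /(bounded_on_gt0 bX)[M M0 CX] /andP[tau0 tau1].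
move=> /(bounded_on_gt0 bX)[S S0 dilX].
pose q := tau^-1; have q1 : 1 < q by rewrite invf_gt1.
have q0 : 0 < q by exact: lt_trans q1.
pose w := q / (q - 1); have w0 : 0 < w by rewrite divr_gt0// subr_gt0.
pose c := w * q ^+ 2; have c0 : 0 < c by rewrite mulr_gt0// exprn_gt0.
exists (c * (S * (S * M))).
  by rewrite (mulr_gt0 c0)// (mulr_gt0 S0)// mulr_gt0.
move=> g Xg; pose h : R -> R := fun x => `|g x|.
have [Xh nh] := bis_abs bX Xg.
have mh : measurable_fun I h by exact: bis_measurable bX _ Xh.
have [[finC XC] nC] := CX _ Xh.
have [[_ XD1] nD1] := dilX _ XC.
have [[_ XD2] nD2] := dilX _ XD1.
set G := fine \o _ in XD2 nD2.
exists (fun x => c * G x); split.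
- exact: bis_scale bX _ _ XD2.
- rewrite (bis_normZ bX)// ger0_norm ?(ltW c0)// -[leRHS]mulrA.
  apply: ler_wpM2l; first exact: ltW.
  apply: le_trans nD2 _; rewrite -[leRHS]mulrA.
  apply: ler_wpM2l; first exact: ltW.
  apply: le_trans nD1 _; rewrite -[leRHS]mulrA.
  apply: ler_wpM2l; first exact: ltW.
  by apply: le_trans nC _; apply: ler_wpM2l nh; exact: ltW.
apply: aeW => x I0x.
have x0 : 0 < x by move: I0x; rewrite /I0 /= in_itv/= andbT.
have Ix y : 0 < y -> I y by move=> y0; rewrite /half_line /= in_itv/= andbT ltW.
pose y := q ^+ 2 * x; have y0 : 0 < y by rewrite mulr_gt0// exprn_gt0.
have GE : G x = fine (cesaro_op h y).
  rewrite /G /= /dilation /= mem_set; last by apply: Ix; rewrite divr_gt0.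
  rewrite /= mem_set/=; last by apply: Ix; rewrite !divr_gt0.
  by congr (fine (cesaro_op _ _)); rewrite /y -mulrA -expr2 mulrC exprVn.
have h0 t : 0 <= h t by exact: normr_ge0.
have int_fin : (\int[leb]_(t in `[0%R, y]) (h t)%:E < +oo)%E.
  have yy : 0 < y < y + 1 by rewrite y0 ltrDl ltr01.
  apply: (upto_integral_fin half_line_initial mh h0 finC yy).
  by apply: Ix; exact: (addr_gt0 y0 ltr01).
have int_ge0 : (0 <= \int[leb]_(t in `[0%R, y]) (h t)%:E)%E.
  by apply: integral_ge0 => t _; rewrite lee_fin.
have G0 : 0 <= G x.
  by rewrite GE fine_ge0// cesaro_op_ge0// ltW.
rewrite [X in (_ <= X%:E)%E]ger0_norm; last exact: (mulr_ge0 (ltW c0) G0).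
have -> : (c * G x)%:E =
    (x^-1%:E * (w%:E * \int[leb]_(t in `[0%R, y]) (h t)%:E))%E.
  have E : (\int[leb]_(t in `[0%R, y]) (h t)%:E)%E =
      (fine (\int[leb]_(t in `[0%R, y]) (h t)%:E))%:E.
    by rewrite fineK// ge0_fin_numE.
  rewrite GE /cesaro_op E -!EFinM /=; congr (_%:E).
  by rewrite /c /y; field; rewrite !gt_eqF.
have rb := half_line_blocks q1.
set p := geom q (geom_index q x + 1).
have px : p <= y.
  rewrite /p geomD1// geomB1// /y expr2 -!mulrA.
  apply: ler_wpM2l; first exact: ltW.
  apply: ler_wpM2l; first exact: ltW.
  exact/ltW/(kappa_gt rb).
have weight t : I0 t -> block_weight leb id I0 (geom_index q) t <= w.
  move=> I0t; rewrite (real_block_weight rb)//.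
  have tp : t <= geom q (geom_index q t) by rewrite -(real_blocksP rb).
  set k := geom_index q t in tp *.
  have -> : geom q k - geom q (k - 1) = (q - 1) * geom q (k - 1).
    by rewrite {1}geomB1// mulrBl mul1r.
  rewrite ler_pdivrMr ?mulr_gt0 ?subr_gt0 ?geom_gt0//.
  by rewrite mulrA divfK ?subr_eq0 ?gt_eqF// -geomB1.
apply: le_trans (majorant_le (w := fun=> w) rb _ _ _ _ _) _ => //.
- exact: bis_measurable bX _ Xg.
- by move=> t I0t _; exact: weight.
- by move=> t _; exact: ltW.
apply: lee_wpmul2l; first by rewrite lee_fin invr_ge0 ltW.
have mhS (z : R) : 0 < z -> measurable_fun `[0, z] (fun t => (h t)%:E).
  move=> z0; apply/measurable_EFinP; apply: measurable_funS mh.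
    exact: measurable_itv.
  exact: (initial_upto half_line_initial (Ix _ z0)).
under eq_integral do rewrite EFinM.
rewrite ge0_integralZl_EFin ?(ltW w0)//; last by apply: mhS; exact: geom_gt0.
apply: lee_wpmul2l; first by rewrite lee_fin ltW.
apply: ge0_subset_integral => //; first exact: mhS.
by move=> t; rewrite /= !in_itv/= => /andP[-> /le_trans ->].
Qed.
End half_line.

(** * The unit interval *)

Section mirror.
Context (R : realType).
Local Notation leb :=
  (@lebesgue_measure R : {measure set (measurableTypeR R) -> \bar R}).
Local Notation I := (@unit_interval R).

Definition mirror (x : measurableTypeR R) : measurableTypeR R := (1 : R) - x.

Lemma measurable_mirror (D : set (measurableTypeR R)) :
  measurable_fun D mirror.
Proof.
apply: measurable_funTS; apply: (@continuous_measurable_fun R _) => x.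
by apply: cvgB; [exact: cvg_cst|exact: cvg_id].
Qed.

Lemma leb_mirror (A : set R) : measurable A -> leb (mirror @^-1` A) = leb A.
Proof.
move=> mA; suff : pushforward leb mirror A = leb A by [].
apply/esym; apply: lebesgue_measure_unique => //=.
  exact: measurable_mirror.
move=> mr _ [[a b]] _ <-; rewrite /pushforward.
have -> : mirror @^-1` `]a, b] = `[1 - b, 1 - a[%classic.
  by apply/seteqP; split=> x; rewrite /mirror /= !in_itv/= => /andP[? ?];
     apply/andP; split; lra.
have [ab|ba] := ltP a b.
  rewrite [LHS]leb_itv// [RHS]leb_itv ?ltrD2l ?ltrN2//.
  by have -> : 1 - a - (1 - b) = b - a by ring.
by rewrite !set_itv_ge ?measure0// bnd_simp -leNgt// lerD2l lerN2.
Qed.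

Lemma integral_mirror (D : set R) (f : R -> \bar R) : measurable D ->
  measurable_fun D f -> (forall x, D x -> (0 <= f x)%E) ->
  (\int[leb]_(x in D) f x = \int[leb]_(x in mirror @^-1` D) f (1 - x)%R)%E.
Proof.
move=> mD mf f0.
have := ge0_integral_pushforward (@measurable_mirror setT) leb mD mf.
rewrite /= => E; rewrite -[RHS]E; last by move=> x /set_mem; exact: f0.
apply: eq_measure_integral; first exact: measurable_mirror.
by move=> mr A mA _; exact: (esym (leb_mirror mA)).
Qed.

Lemma mirror_unit x : I (1 - x) = I x.
Proof.
rewrite /unit_interval /= !in_itv/=; apply/propext.
by split=> /andP[? ?]; apply/andP; split; lra.
Qed.

(** A function and its mirror image are equimeasurable. This is what allows
    estimates at one end of the interval to be used at the other. *)
Lemma symmetric_mirror (X : fun_space R R) (f : R -> R) :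
  symmetric_space leb I X -> X f ->
  X (fun x => f (1 - x)) /\ fnorm X (fun x => f (1 - x)) = fnorm X f.
Proof.
move=> [bX symX] Xf.
have mf : measurable_fun I f by exact: bis_measurable bX _ Xf.
have mI : measurable I by exact: measurable_itv.
apply: symX => //.
  apply: (measurable_comp (F := I) (g := mirror)) => //.
    by move=> _ [x Ix <-]; rewrite /mirror mirror_unit.
  exact: measurable_mirror.
move=> l l0; set A := [set x | _].
have mA : measurable A.
  have := measurable_abs mf mI (measurable_itv `]l, +oo[).
  congr (measurable _); apply/seteqP; split => x [Ix]/=;
  by rewrite ?in_itv/= ?andbT => ?; split => //=; rewrite ?in_itv/= ?andbT.
rewrite -leb_mirror//; congr (_ _); apply/seteqP.
by split=> x; rewrite /A /= ?mirror_unit.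
Qed.

End mirror.

Section unit_interval.
Context (R : realType).
Local Notation leb :=
  (@lebesgue_measure R : {measure set (measurableTypeR R) -> \bar R}).
Local Notation upto := (fun x : R => `[0, x]%classic).
Local Notation I := (@unit_interval R).

Lemma unit_interval_initial : initial_interval I.
Proof.
split; first exact: interval_is_interval.
  by move=> x; rewrite /unit_interval /= !in_itv/= => /andP[->].
move=> x; rewrite /unit_interval /= in_itv/= => /andP[_ x1] t.
by rewrite /= !in_itv/= => /andP[-> /le_trans ->].
Qed.

Let I0 : set R := `]0, 1[%classic.

Let I0I x : I0 x -> I x.
Proof. by rewrite /I0 /unit_interval /= !in_itv/= => /andP[/ltW-> /ltW]. Qed.

(** A partition of the open unit interval that is dyadic at both ends: these
    are the points at which [x / (1 - x)] is a power of two. *)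
Definition logistic (k : int) : R := geom 2 k / (1 + geom 2 k).

Definition logistic_index (x : R) : int := geom_index 2 (x / (1 - x)).

Let two1 : 1 < 2 :> R. Proof. by rewrite ltr1n. Qed.

Let logistic_itv k : 0 < logistic k < 1.
Proof.
have e0 := geom_gt0 (2 : R) k.
rewrite /logistic divr_gt0 ?addr_gt0//= ltr_pdivrMr ?addr_gt0//; lra.
Qed.

Lemma logistic_blocks : real_blocks I I0 logistic_index logistic.
Proof.
split.
- exact: unit_interval_initial.
- exact: interval_is_interval.
- exact: I0I.
- exists ([set (0 : R)] `|` [set (1 : R)]); split.
  + by apply: measurableU; exact: measurable_set1.
  + by apply: null_set_setU; rewrite ?leb_set1.
  move=> x /=; rewrite /I0 /unit_interval /= !in_itv/=.
  move=> /not_implyP[/andP[x0 x1] /negP]; rewrite negb_and -!leNgt.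
  by move=> /orP[x0'|x1']; [left|right]; apply: le_anti;
     rewrite ?x0 ?x0' ?x1 ?x1'.
- by move=> x; rewrite /I0 /= in_itv/= => /andP[].
- move=> x k; rewrite /I0 /= in_itv/= => /andP[x0 x1].
  have e0 := geom_gt0 (2 : R) k.
  rewrite /logistic_index geom_indexP ?divr_gt0 ?subr_gt0//.
  rewrite ler_pdivrMr ?subr_gt0// /logistic ler_pdivlMr ?addr_gt0//.
  by apply/idP/idP; lra.
- by move=> k; rewrite /I0 /= in_itv/= logistic_itv.
- move=> k; have e0 := geom_gt0 (2 : R) (k - 1).
  rewrite /logistic (geomB1 two1 k) ltr_pdivrMr ?addr_gt0// mulrAC.
  by rewrite ltr_pdivlMr ?addr_gt0 ?mulr_gt0//; nra.
Qed.

Lemma logistic_weight t : I0 t ->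
  block_weight leb id I0 logistic_index t <= 2 / (1 - t).
Proof.
move=> I0t; rewrite (real_block_weight logistic_blocks)//.
have tp : t <= logistic (logistic_index t).
  by rewrite -(real_blocksP logistic_blocks).
have pt := kappa_gt logistic_blocks I0t.
move: I0t; rewrite /I0 /= in_itv/= => /andP[t0 t1].
set k := logistic_index t in tp pt *.
have e0 := geom_gt0 (2 : R) (k - 1).
move: tp pt; rewrite /logistic (geomB1 two1 k).
set e := geom 2 (k - 1) in e0 *.
have e1 : 0 < 1 + e by rewrite addr_gt0.
have e2 : 0 < 1 + 2 * e by rewrite addr_gt0// mulr_gt0.
rewrite ler_pdivlMr// ltr_pdivrMr// => tp pt.
have -> : 2 * e / (1 + 2 * e) - e / (1 + e) = e / ((1 + 2 * e) * (1 + e)).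
  by field; rewrite !gt_eqF.
have u0 : 0 < 1 - t by rewrite subr_gt0.
rewrite ler_pdivrMr; last by rewrite divr_gt0// mulr_gt0.
have -> : 2 / (1 - t) * (e / ((1 + 2 * e) * (1 + e))) =
    2 * e / ((1 - t) * (1 + 2 * e) * (1 + e)).
  by field; rewrite !gt_eqF.
rewrite ler_pdivlMr; last by rewrite !mulr_gt0.
have -> : t * ((1 - t) * (1 + 2 * e) * (1 + e)) =
    (t * (1 + 2 * e)) * ((1 - t) * (1 + e)) by ring.
rewrite -[leRHS]mulr1; apply: ler_pM => //; last by lra.
- by rewrite mulr_ge0 ?ltW.
- by rewrite mulr_ge0 ?ltW.
Qed.

(** Moving from [x] to the end [p] of the next block changes neither the
    distance to [0] nor the distance to [1] by more than the factor [4]. *)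
Lemma logistic_next x : I0 x -> let p := logistic (logistic_index x + 1) in
  [/\ x < p, p <= 4 * x, 1 - x <= 4 * (1 - p) & (x <= 2^-1 -> p <= 2 / 3)].
Proof.
move=> I0x; have rb := logistic_blocks.
have xk : x <= logistic (logistic_index x) by rewrite -(real_blocksP rb).
have kx := kappa_gt rb I0x.
move=> p; have xp : x < p.
  apply: le_lt_trans xk _; have := real_blocks_lt rb (logistic_index x + 1).
  by rewrite addrK.
move: I0x; rewrite /I0 /= in_itv/= => /andP[x0 x1].
set k := logistic_index x in xk kx p xp *.
have e0 := geom_gt0 (2 : R) (k - 1).
have pE : p = 4 * geom 2 (k - 1) / (1 + 4 * geom 2 (k - 1)).
  rewrite /p /logistic (geomD1 two1 k) (geomB1 two1 k) mulrA.
  by rewrite -natrM.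
have k0 : x <= 2^-1 -> geom 2 (k - 1) <= 2^-1 :> R.
  move=> x2; have kle : k <= 0.
    rewrite /k (real_blocksP rb) ?/I0 /= ?in_itv/= ?x0//.
    by rewrite /logistic geom0 div1r.
  have := le_geom two1 (_ : k - 1 <= 0 - 1).
  rewrite lerD2r => /(_ kle); have := geomB1 two1 0; rewrite geom0; lra.
move: kx; rewrite /logistic pE.
set e := geom 2 (k - 1) in e0 k0 *.
have e1 : 0 < 1 + e by rewrite addr_gt0.
have e4 : 0 < 1 + 4 * e by rewrite addr_gt0// mulr_gt0.
rewrite ltr_pdivrMr// => kx; split => //.
- by rewrite -pE.
- by rewrite ler_pdivrMr//; have xe := mulr_gt0 x0 e0; lra.
- have -> : 4 * (1 - 4 * e / (1 + 4 * e)) = 4 / (1 + 4 * e).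
    by field; rewrite gt_eqF.
  by rewrite ler_pdivlMr//; have xe := mulr_gt0 x0 e0; lra.
- by move=> /k0 ?; rewrite ler_pdivrMr//; lra.
Qed.

Section one_space.
Variable h : R -> R.
Hypotheses (mh : measurable_fun I h) (h0 : forall t, 0 <= h t).

Let mS (J : set R) (f : R -> R) : measurable J -> J `<=` I ->
  measurable_fun I f -> measurable_fun J (fun t => (f t)%:E).
Proof.
move=> mJ JI mf; apply/measurable_EFinP; apply: measurable_funS mf => //.
exact: measurable_itv.
Qed.

Let sub_itv (b0 b1 : bool) a b : 0 <= a -> b <= 1 ->
  [set` Interval (BSide b0 a) (BSide b1 b)] `<=` I.
Proof.
move=> a0 b1' t; rewrite /unit_interval /= !itv_boundlr !bnd_simp.
move=> /andP[at_ tb]; apply/andP; split.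
  by move: at_; case: b0; rewrite bnd_simp => ?; lra.
by move: tb; case: b1; rewrite bnd_simp => ?; lra.
Qed.

Let lt_three_halves (p : R) : 0 < p -> p < 3 / 2 * p. Proof. lra. Qed.

Let three_halves_le (p : R) : p <= 2 / 3 -> 3 / 2 * p <= 1. Proof. lra. Qed.

Let sqr_le (t p : R) : 0 <= t -> t <= 3 / 2 * p ->
  4 / 9 * t ^+ 2 <= p ^+ 2.
Proof.
move=> t0 tp; have : t ^+ 2 <= (3 / 2 * p) ^+ 2.
  by rewrite ler_sqr// nnegrE (le_trans t0).
by rewrite exprMn; lra.
Qed.

Let adj_sub (x : R) : measurable (I `&` `[x, +oo[).
Proof. by apply: measurableI; exact: measurable_itv. Qed.

Let measurable_div (H : R -> R) : measurable_fun I H ->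
  measurable_fun I (fun t => H t / t).
Proof.
move=> mH; apply: measurable_funM => //; apply: measurable_fun_inv.
exact: initial_ge0 unit_interval_initial.
Qed.

(** For [t] between [p] and [3 p / 2], the average of [h] at [t] is at least
    [1 / t] times the integral of [h] up to [p]; integrating this over that
    interval already gives the bound. Thus [C* C] controls averages at points
    comparable to [x] but larger, in place of a dilation. *)
Lemma cesaro_adj_ge (x p : R) :
  {ae leb, forall x, I x -> cesaro_op h x \is a fin_num} ->
  measurable_fun I (fine \o cesaro_op h) ->
  x <= p -> 0 < p <= 2 / 3 ->
  ((2 / 9 / p)%:E * \int[leb]_(t in `[0%R, p]) (h t)%:E <=
    cesaro_adj_op I (fine \o cesaro_op h) x)%E.
Proof.
move=> fin mC xp /andP[p0 p23].
have p1 : p < 1 by lra.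
have I1 : I 1 by rewrite /unit_interval /= in_itv/= ler01 lexx.
have p01 : 0 < p < 1 by rewrite p0.
have int_fin := upto_integral_fin unit_interval_initial mh h0 fin p01 I1.
have int_ge0 : (0 <= \int[leb]_(t in `[0%R, p]) (h t)%:E)%E.
  by apply: integral_ge0 => t _; rewrite lee_fin.
set r := fine (\int[leb]_(t in `[0%R, p]) (h t)%:E)%E.
have rE : (\int[leb]_(t in `[0%R, p]) (h t)%:E)%E = r%:E.
  by rewrite fineK// ge0_fin_numE.
have r0 : 0 <= r by rewrite fine_ge0.
pose c := 4 / 9 / p ^+ 2.
have c0 : 0 <= c by rewrite divr_ge0// sqr_ge0.
pose q := 3 / 2 * p.
have pq : p < q := lt_three_halves p0.
have q1 : q <= 1 := three_halves_le p23.
have JI : `[p, q] `<=` I by apply: sub_itv => //; exact: ltW.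
have mJ : measurable (`[p, q] : set (measurableTypeR R)).
  exact: measurable_itv.
have H0 t : I t -> 0 <= (fine \o cesaro_op h) t / t.
  rewrite /unit_interval /= in_itv/= => /andP[t0 _].
  by rewrite divr_ge0// fine_ge0// cesaro_op_ge0.
rewrite rE.
apply: (@le_trans _ _ (\int[leb]_(t in `[p, q]) (cst (c * r)%:E t))%E).
  rewrite integral_cst//.
  have -> : leb `[p, q]%classic = (q - p)%:E by exact: leb_itv.
  rewrite -!EFinM lee_fin.
  have -> : c * r * (q - p) = 2 / 9 / p * r; last exact: lexx.
  by rewrite /c /q; field; rewrite gt_eqF.
apply: (@le_trans _ _
    (\int[leb]_(t in `[p, q]) ((fine \o cesaro_op h) t / t)%:E)%E).
  apply: ae_ge0_le_integral => //.
  - by move=> t _; rewrite lee_fin mulr_ge0.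
  - by move=> t /JI It; rewrite lee_fin H0.
  - by apply: (mS mJ JI); exact: measurable_div.
  apply: (@filterS _ _ (ae_filter_ringOfSetsType leb) _ _ _ fin) => t + Jt.
  move=> /(_ (JI _ Jt)) fint.
  move: (Jt); rewrite /= in_itv/= => /andP[pt tq].
  have t0 : 0 < t by exact: lt_le_trans pt.
  have tE : (\int[leb]_(s in `[0%R, t]) (h s)%:E)%E =
      (t * fine (cesaro_op h t))%:E.
    exact: (average_fin (mu := leb) (A := upto) (v := id) t0 fint).
  have : r <= t * fine (cesaro_op h t).
    rewrite -lee_fin -rE -tE; apply: ge0_subset_integral => //.
    - by apply: (mS _ _ mh); [exact: measurable_itv|exact: sub_itv (lexx 0) (le_trans tq q1)].
    - by move=> s _; rewrite lee_fin.
    - by move=> s; rewrite /= !in_itv/= => /andP[-> /le_trans ->].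
  move=> /(ler_wpM2l c0) rle; rewrite lee_fin; apply: le_trans rle _ => /=.
  rewrite ler_pdivlMr// [c * _]mulrA mulrAC ler_piMl//.
    by rewrite fine_ge0// cesaro_op_ge0// ltW.
  have -> : c * t * t = 4 / 9 * t ^+ 2 / p ^+ 2.
    by rewrite /c; field; rewrite gt_eqF.
  rewrite ler_pdivrMr ?exprn_gt0// mul1r.
  exact: (sqr_le (ltW t0) tq).
apply: ge0_subset_integral => //.
- exact: adj_sub.
- exact: (mS (adj_sub x) (@subIsetl _ _ _) (measurable_div mC)).
- by move=> t [It _]; rewrite lee_fin H0.
- move=> t Jt; split; first exact: JI.
  move: Jt; rewrite /= !in_itv/= andbT => /andP[pt _].
  exact: le_trans pt.
Qed.

Lemma measurable_inv_sub (p : R) : p <= 1 ->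
  measurable_fun (`[0, p] : set R) (fun t : R => (1 - t)^-1).
Proof.
move=> p1; pose F : set R := `[0, +oo[%classic.
apply: (measurable_comp (F := F) (f := fun x : R => x^-1) (g := @mirror R)).
- exact: measurable_itv.
- move=> _ [t tp <-]; move: tp; rewrite /F /mirror /= in_itv/= => /andP[_ tp].
  by rewrite in_itv/= andbT subr_ge0 (le_trans tp).
- exact: measurable_fun_inv.
- exact: measurable_mirror.
Qed.

Let weighted_measurable (p : R) : p <= 1 ->
  measurable_fun (`[0, p] : set R) (fun t => (h t / (1 - t))%:E).
Proof.
move=> p1; apply/measurable_EFinP; apply: measurable_funM.
  apply: measurable_funS mh; first exact: measurable_itv.
  by apply: sub_itv.
exact: measurable_inv_sub.
Qed.

Let weighted_pos (p : R) t : p <= 1 -> `[0, p]%classic t -> 0 <= h t / (1 - t).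
Proof.
by move=> p1; rewrite /= in_itv/= => ?; rewrite divr_ge0//; lra.
Qed.

Lemma cesaro_adj_mirror (p : R) : 0 < p <= 1 ->
  cesaro_adj_op I (fun x => h (1 - x)) (1 - p) =
  (\int[leb]_(t in `[0%R, p]) (h t / (1 - t))%:E)%E.
Proof.
move=> /andP[p0 p1].
rewrite integral_mirror; first last.
- by move=> t pt; rewrite lee_fin (weighted_pos p1).
- exact: weighted_measurable.
- exact: measurable_itv.
rewrite /cesaro_adj_op.
have -> : I `&` `[1 - p, +oo[ = @mirror R @^-1` `[0, p].
  apply/seteqP; split=> t; rewrite /unit_interval /mirror /= !in_itv/=.
    by move=> [] /andP[? ?] /andP[? ?]; apply/andP; split; lra.
  by move=> /andP[? ?]; split; apply/andP; split => //; lra.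
by apply: eq_integral => t _; rewrite opprB addrCA subrr addr0.
Qed.

(** The integral on the left is the value at [1 - p] of [C*] applied to the
    mirrored function. As [C*] of a nonnegative function decreases, its
    average at [1 - x] is at least that value times [(1 - p) / (1 - x)]. *)
Lemma cesaro_mirror_ge (x p : R) :
  let H := fine \o cesaro_adj_op I (fun x => h (1 - x)) in
  {ae leb, forall x, I x ->
    cesaro_adj_op I (fun x => h (1 - x)) x \is a fin_num} ->
  measurable_fun I H -> 0 < x <= p -> p < 1 ->
  (((1 - p) / (1 - x))%:E * \int[leb]_(t in `[0%R, p]) (h t / (1 - t))%:E <=
    cesaro_op H (1 - x))%E.
Proof.
move=> H fin mH /andP[x0 xp] p1.
have p01 : 0 < p <= 1 by rewrite (lt_le_trans x0 xp) ltW.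
rewrite -cesaro_adj_mirror//; set r := cesaro_adj_op _ _ _.
have mhr : measurable_fun I (fun t => h (1 - t)).
  apply: (measurable_comp (F := I) (g := @mirror R)) => //.
  - exact: measurable_itv.
  - by move=> _ [t It <-]; rewrite /mirror mirror_unit.
  - exact: measurable_mirror.
have mdiv y : measurable_fun (I `&` `[y, +oo[) (fun t => (h (1 - t) / t)%:E).
  exact: (mS (adj_sub y) (@subIsetl _ _ _) (measurable_div mhr)).
have div0 t : I t -> 0 <= h (1 - t) / t.
  by rewrite /unit_interval /= in_itv/= => /andP[t0 _]; rewrite divr_ge0.
have adj0 y : (0 <= cesaro_adj_op I (fun x => h (1 - x)) y)%E.
  by apply: integral_ge0 => t [It _]; rewrite lee_fin div0.
have H0 y : 0 <= H y by rewrite fine_ge0.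
have mJ y : measurable (`[0, y] : set (measurableTypeR R)).
  exact: measurable_itv.
have JI y : y <= 1 -> `[0, y] `<=` I by move=> y1; exact: sub_itv.
have lower : (r * (1 - p)%:E <= \int[leb]_(s in `[0%R, (1 - p)%R]) (H s)%:E)%E.
  have E : leb `[0, 1 - p]%classic = (1 - p)%:E.
    by rewrite -[in RHS](subr0 (1 - p)); apply: leb_itv; rewrite subr_gt0.
  rewrite -E -integral_cst//; apply: ae_ge0_le_integral => //.
  - by move=> s _; rewrite adj0.
  - by move=> s _; rewrite lee_fin.
  - by apply: (mS (mJ _)) => //; apply: JI; lra.
  apply: (@filterS _ _ (ae_filter_ringOfSetsType leb) _ _ _ fin) => s + Js.
  have Is : I s by apply: JI Js; lra.
  move=> /(_ Is) fins; rewrite /= /H /= fineK//.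
  apply: ge0_subset_integral => //.
  - exact: adj_sub.
  - exact: adj_sub.
  - exact: mdiv.
  - by move=> t [It _]; rewrite lee_fin div0.
  - move=> t [It /=]; rewrite !in_itv/= !andbT => pt; split => //=.
    by move: Js; rewrite /= in_itv/=; lra.
have x1 : 0 < 1 - x by lra.
rewrite [((1 - p) / (1 - x))%R]mulrC EFinM -muleA.
apply: lee_wpmul2l; first by rewrite lee_fin invr_ge0 ltW.
rewrite muleC; apply: le_trans lower _.
apply: ge0_subset_integral => //.
- by apply: (mS (mJ _)) => //; apply: JI; lra.
- by move=> t _; rewrite lee_fin.
- by move=> t; rewrite /= !in_itv/= => /andP[-> ?] /=; lra.
Qed.

End one_space.

Let six_le (t : R) : t <= 2 / 3 -> 2 <= 6 * (1 - t). Proof. lra. Qed.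

Let near_le (x p r G : R) : 0 < x -> 0 < p -> 0 <= G -> p <= 4 * x ->
  2 / 9 / p * r <= G -> x^-1 * (6 * r) <= 108 * G.
Proof.
move=> x0 p0 G0 px rG; rewrite mulrC ler_pdivrMr//.
have : r <= (9 / 2 * p) * G.
  have -> : r = 9 / 2 * p * (2 / 9 / p * r) by field; rewrite gt_eqF.
  by apply: ler_wpM2l rG; lra.
have : p * G <= 4 * x * G by apply: ler_wpM2r.
lra.
Qed.

Let far_le (x p r G : R) : 2^-1 < x -> 0 < 1 - x -> 1 - x <= 4 * (1 - p) ->
  0 <= r -> (1 - p) / (1 - x) * r <= G -> x^-1 * (2 * r) <= 16 * G.
Proof.
move=> x2 x1 xp r0 rG; have x0 : 0 < x by lra.
have quarter : 4^-1 <= (1 - p) / (1 - x) by rewrite ler_pdivlMr//; lra.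
have rG' := le_trans (ler_wpM2r r0 quarter) rG.
have G0 : 0 <= G by lra.
have xG : 2^-1 * G <= x * G by apply: ler_wpM2r => //; exact: ltW.
by rewrite mulrC ler_pdivrMr//; lra.
Qed.

(** The weight is at most [2 / (1 - t)]. For [x <= 1 / 2] it is bounded on the
    interval of integration, and [C* C |g|] dominates the majorant; for [x > 1
    / 2] the factor [1 / x] is harmless, and the mirror image of [C C*]
    applied to the mirrored [|g|] does. *)
Lemma unit_interval_majorant (X : fun_space R R) :
  symmetric_space leb I X -> bounded_on leb I (@cesaro_op R) X ->
  bounded_on leb I (cesaro_adj_op I) X ->
  majorant_bounded leb id I0 logistic_index X.
Proof.
move=> symX; have bX := symX.1.
move=> /(bounded_on_gt0 bX)[M M0 CX] /(bounded_on_gt0 bX)[N N0 AX].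
exists (124 * (M * N)); first by rewrite mulr_gt0// mulr_gt0.
move=> g Xg; pose h : R -> R := fun x => `|g x|.
have [Xh nh] := bis_abs bX Xg.
have mh : measurable_fun I h by exact: bis_measurable bX _ Xh.
have h0 t : 0 <= h t by exact: normr_ge0.
have [[finC XC] nC] := CX _ Xh.
have [[finAC XAC] nAC] := AX _ XC.
have [Xr nr] := symmetric_mirror symX Xh.
have [[finA XA] nA] := AX _ Xr.
have [[finCA XCA] nCA] := CX _ XA.
have [XG2 nG2] := symmetric_mirror symX XCA.
set G1 := fine \o cesaro_adj_op I _ in XAC nAC.
set H := fine \o cesaro_adj_op I _ in XA nA finCA XCA nCA XG2 nG2.
pose G2 x := (fine \o cesaro_op H) (1 - x).
have X1 : X (fun x => 108 * G1 x) by exact: bis_scale bX _ _ XAC.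
have X2 : X (fun x => 16 * G2 x) by exact: bis_scale bX _ _ XG2.
exists ((fun x => 108 * G1 x) \+ (fun x => 16 * G2 x)); split.
- exact: bis_add bX _ _ X1 X2.
- apply: le_trans (bis_normD bX X1 X2) _.
  rewrite !(bis_normZ bX)// !ger0_norm// nG2.
  have b1 : fnorm X G1 <= M * N * fnorm X g.
    apply: le_trans nAC _; rewrite [M * N]mulrC -mulrA.
    apply: ler_wpM2l; first exact: ltW.
    by apply: le_trans nC _; apply: ler_wpM2l nh; exact: ltW.
  have b2 : fnorm X (fine \o cesaro_op H) <= M * N * fnorm X g.
    apply: le_trans nCA _; rewrite -mulrA.
    apply: ler_wpM2l; first exact: ltW.
    apply: le_trans nA _; apply: ler_wpM2l; first exact: ltW.
    by rewrite nr.
  have -> : 124 * (M * N) * fnorm X g =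
      108 * (M * N * fnorm X g) + 16 * (M * N * fnorm X g) by ring.
  by apply: lerD; apply: ler_wpM2l.
have rb := logistic_blocks.
have iI := unit_interval_initial.
have mH : measurable_fun I H by exact: bis_measurable bX _ XA.
have mC : measurable_fun I (fine \o cesaro_op h).
  exact: bis_measurable bX _ XC.
have hr0 t : I t -> 0 <= h (1 - t) / t.
  by rewrite /unit_interval /= in_itv/= => /andP[t0 _]; rewrite divr_ge0.
have H0 t : 0 <= H t.
  by rewrite fine_ge0//; apply: integral_ge0 => s [Is _]; rewrite lee_fin hr0.
have C0 t : I t -> 0 <= (fine \o cesaro_op h) t / t.
  rewrite /unit_interval /= in_itv/= => /andP[t0 _].
  by rewrite divr_ge0// fine_ge0// cesaro_op_ge0.
have G10 t : 0 <= G1 t.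
  by rewrite fine_ge0//; apply: integral_ge0 => s [Is _]; rewrite lee_fin C0.
have G20 t : I0 t -> 0 <= G2 t.
  rewrite /I0 /= in_itv/= => /andP[_ t1].
  by rewrite fine_ge0// cesaro_op_ge0// subr_ge0 ltW.
apply: filterS finAC => x finx I0x; have Ix := I0I I0x.
rewrite ger0_norm ?addr_ge0 ?mulr_ge0// ?G20//.
have [xp px x1p near0] := logistic_next I0x.
set p := logistic _ in xp px x1p near0.
have /andP[p0 p1] : 0 < p < 1 by exact: logistic_itv.
move: (I0x); rewrite /I0 /= in_itv/= => /andP[x0 x1].
apply: le_trans (majorant_le (w := fun t => 2 / (1 - t)) rb _ _ _ _ _) _ => //.
- exact: bis_measurable bX _ Xg.
- apply: measurable_funM => //; exact: (measurable_inv_sub (ltW p1)).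
- by move=> t I0t _; exact: logistic_weight.
- move=> t; rewrite -/p => /andP[_ tp].
  by rewrite divr_ge0// subr_ge0 (le_trans tp)// ltW.
have m01 : measurable (`[0, p] : set (measurableTypeR R)).
  exact: measurable_itv.
have sub01 : `[0, p] `<=` I.
  exact: (initial_upto unit_interval_initial (I0I (real_blocks_point rb _))).
have mg : measurable_fun (`[0, p] : set R) (fun t => (h t)%:E).
  apply/measurable_EFinP; apply: measurable_funS mh => //.
  exact: measurable_itv.
have mi := measurable_inv_sub (ltW p1).
have finE (J : \bar R) (a b : R) : 0 < a -> (0 <= J)%E ->
    (a%:E * J <= b%:E)%E -> exists2 r, 0 <= r & J = r%:E.
  move=> a0; case: J => [r r0 _|_|//]; first by exists r.
  by rewrite mulry gtr0_sg// mul1e leye_eq.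
have t_lt1 t : `[0, p]%classic t -> 0 < 1 - t.
  by rewrite /= in_itv/= subr_gt0 => /andP[_ tp]; exact: le_lt_trans p1.
rewrite -/p; have [x2|x2] := leP x 2^-1.
  have p23 : 0 < p <= 2 / 3 by rewrite p0 near0.
  have := cesaro_adj_ge mh h0 finC mC (ltW xp) p23.
  rewrite -(fineK (finx Ix)) -/(G1 x).
  set J := integral _ _ _ => JG.
  have J0 : (0 <= J)%E by apply: integral_ge0 => t _; rewrite lee_fin.
  have [r r0 JE] : exists2 r, 0 <= r & J = r%:E.
    by apply: finE JG => //; rewrite divr_gt0.
  apply: (@le_trans _ _ (x^-1%:E * (6%:E * J))%E).
    apply: lee_wpmul2l; first by rewrite lee_fin invr_ge0 ltW.
    rewrite -ge0_integralZl_EFin//; last by move=> t _; rewrite lee_fin.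
    apply: ge0_le_integral => //.
    - by move=> t /t_lt1/ltW t1; rewrite lee_fin mulr_ge0// divr_ge0.
    - apply/measurable_EFinP; apply: measurable_funM.
        exact: measurable_funM.
      exact/measurable_EFinP.
    - exact: measurable_funeM.
    - move=> t It; rewrite -EFinM lee_fin; apply: ler_wpM2r => //.
      rewrite ler_pdivrMr ?t_lt1//; move: It p23.
      rewrite /= in_itv/= => /andP[_ tp] /andP[_ p23].
      exact: six_le (le_trans tp p23).
  move: JG; rewrite JE -!EFinM !lee_fin => JG.
  apply: (@le_trans _ _ (108 * G1 x)).
    exact: (near_le x0 p0 (G10 x) px JG).
  by rewrite lerDl mulr_ge0// G20.
have xp' : 0 < x <= p by rewrite x0 ltW.
have x1' : 0 < 1 - x by rewrite subr_gt0.
have := cesaro_mirror_ge mh h0 finA mH xp' p1; rewrite -/H.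
have fin2 : cesaro_op H (1 - x) \is a fin_num.
  have xx : 0 < 1 - x < 1 by rewrite x1' ltrBlDr ltrDl.
  have I1 : I 1 by rewrite /unit_interval /= in_itv/= ler01 lexx.
  have y := upto_integral_fin iI mH H0 finCA xx I1.
  have y0 : (0 <= \int[leb]_(t in `[0%R, (1 - x)%R]) (H t)%:E)%E.
    by apply: integral_ge0 => t _; rewrite lee_fin.
  by rewrite /cesaro_op fin_numM// ge0_fin_numE.
rewrite -(fineK fin2) -/(G2 x); set J := integral _ _ _ => JG.
have J0 : (0 <= J)%E.
  by apply: integral_ge0 => t /t_lt1/ltW t1; rewrite lee_fin divr_ge0.
have [r r0 JE] : exists2 r, 0 <= r & J = r%:E.
  by apply: finE JG => //; rewrite divr_gt0// subr_gt0.
have -> : (\int[leb]_(t in `[0%R, p]) (2 / (1 - t) * `|g t|)%:E = 2%:E * J)%E.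
  rewrite -ge0_integralZl_EFin//; first last.
  - apply/measurable_EFinP; apply: measurable_funM => //.
    exact/measurable_EFinP.
  - by move=> t /t_lt1/ltW t1; rewrite lee_fin divr_ge0.
  apply: eq_integral => t _; rewrite -EFinM; congr (_%:E).
  by rewrite /h -mulrA [_^-1 * _]mulrC.
move: JG; rewrite JE -!EFinM !lee_fin => JG.
apply: (@le_trans _ _ (16 * G2 x)); last by rewrite lerDr mulr_ge0.
exact: (far_le x2 x1' x1p r0 JG).
Qed.

End unit_interval.

(** * The Hahn-Banach theorem in finite dimension *)

Section sublinear.
Context (R : realType) (V : lmodType R).

Definition sublinear (p : V -> R) :=
  (forall x y, p (x + y) <= p x + p y) /\
  (forall t x, 0 <= t -> p (t *: x) = t * p x).

(** Take for [q x] the infimum of [p (x + t v) - t p v] over [t >= 0]. With [q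
    v <= p v] the last bound says that [q] is linear on the line of [v]. *)
Lemma sublinear_flatten (p : V -> R) (v : V) : sublinear p ->
  exists q, [/\ sublinear q, forall x, q x <= p x & q (- v) <= - p v].
Proof.
move=> [pD pZ].
pose S x := [set r | exists2 t, 0 <= t & r = p (x + t *: v) - t * p v].
pose q x := inf (S x).
have p0 : p 0 = 0 by rewrite -(scale0r 0) pZ ?mul0r.
have S0 x : S x (p x) by exists 0 => //; rewrite scale0r addr0 mul0r subr0.
have lbS x : has_lbound (S x).
  exists (- p (- x)) => _ [t t0 ->].
  have := pD (x + t *: v) (- x); rewrite addrAC subrr add0r pZ//; lra.
have qle x t : 0 <= t -> q x <= p (x + t *: v) - t * p v.
  by move=> t0; apply: ge_inf => //; exists t.
have le_q x c : (forall t, 0 <= t -> c <= p (x + t *: v) - t * p v) -> c <= q x.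
  move=> h; apply: lb_le_inf; first by exists (p x).
  by move=> _ [t t0 ->]; exact: h.
have qp x : q x <= p x.
  by have := qle x 0 (lexx _); rewrite scale0r addr0 mul0r subr0.
have qZ t x : 0 < t -> q (t *: x) <= t * q x.
  move=> t0; rewrite -ler_pdivrMl//; apply: le_q => s s0.
  rewrite ler_pdivrMl//; apply: le_trans (qle _ (t * s) _) _.
    by rewrite mulr_ge0// ltW.
  by rewrite -scalerA -scalerDr pZ ?(ltW t0)// mulrBr mulrA.
exists q; split => //; last first.
  by apply: le_trans (qle _ 1 _) _ => //; rewrite scale1r addNr p0 mul1r sub0r.
split => [x y|t x].
  rewrite -lerBlDr; apply: (le_q x) => s s0; rewrite lerBlDr -lerBlDl.
  apply: (le_q y) => t t0; rewrite lerBlDl.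
  apply: le_trans (qle _ (s + t) _) _; first exact: addr_ge0.
  rewrite scalerDl addrACA; have := pD (x + s *: v) (y + t *: v); lra.
rewrite le_eqVlt => /predU1P[<-|t0].
  rewrite scale0r mul0r; apply: le_anti; rewrite (le_trans (qp 0)) ?p0//=.
  by apply: le_q => s s0; rewrite add0r pZ// subrr.
apply: le_anti; rewrite qZ//= -ler_pdivlMl//.
have := qZ t^-1 (t *: x); rewrite invr_gt0 scalerA mulVf ?gt_eqF// scale1r.
exact.
Qed.

Lemma sublinear_flatten_seq (p : V -> R) (s : seq V) : sublinear p ->
  exists q, [/\ sublinear q, forall x, q x <= p x &
    forall v, v \in s -> q v + q (- v) <= 0].
Proof.
move=> sp; elim: s => [|v s [q [sq qp qs]]]; first by exists p.
have [q' [sq' q'q q'v]] := sublinear_flatten v sq.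
exists q'; split => // [x|w]; first exact: le_trans (qp x).
rewrite inE => /predU1P[->|ws]; first by have := q'q v; lra.
have := qs _ ws; have := q'q w; have := q'q (- w); lra.
Qed.

End sublinear.

(** Flatten [p] first along [h], so that every smaller sublinear function
    agrees with [p] at [h], and then along a basis: what remains is linear. *)
Lemma hahn_banach_row (R : realType) n (p : 'rV[R]_n -> R) (h : 'rV[R]_n) :
  sublinear p -> exists u : 'rV[R]_n,
    (forall x : 'rV[R]_n, \sum_j u 0 j * x 0 j <= p x) /\
    \sum_j u 0 j * h 0 j = p h.
Proof.
move=> sp; have [q [sq qp qh]] := sublinear_flatten h sp.
have [r [[rD rZ] rq rb]] :=
  sublinear_flatten_seq [seq delta_mx 0 j | j <- enum 'I_n] sq.
have r0 : r 0 = 0 by rewrite -(scale0r 0) rZ ?mul0r.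
have rN (x : 'rV[R]_n) : 0 <= r x + r (- x).
  by rewrite -r0 -(subrr x); exact: rD.
have rE (x : 'rV[R]_n) : r x = \sum_j r (delta_mx 0 j) * x 0 j.
  have rZ' (c : R) (j : 'I_n) : r (c *: delta_mx 0 j) = c * r (delta_mx 0 j).
    have : r (delta_mx 0 j) + r (- delta_mx 0 j) <= 0.
      by apply: rb; apply/mapP; exists j; rewrite ?mem_enum.
    have := rN (delta_mx 0 j) => rj0 rj1.
    have rjN : r (- delta_mx 0 j) = - r (delta_mx 0 j) by lra.
    have [c0|/ltW c0] := leP 0 c; first exact: rZ.
    have := rZ (- c) (- delta_mx 0 j); rewrite oppr_ge0 scalerN scaleNr opprK.
    by move=> ->//; rewrite rjN; lra.
  have rDZ (y : 'rV[R]_n) (c : R) (j : 'I_n) :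
      r (y + c *: delta_mx 0 j) = r y + c * r (delta_mx 0 j).
    apply: le_anti; rewrite -{1}rZ' rD/=.
    have := rD (y + c *: delta_mx 0 j) ((- c) *: delta_mx 0 j).
    by rewrite rZ' scaleNr addrK; lra.
  rewrite [in LHS](row_sum_delta x).
  elim/big_rec2 : _ => [|j a y _ <-]; first exact: r0.
  by rewrite addrC rDZ addrC mulrC.
exists (\row_j r (delta_mx 0 j)).
have sumE (x : 'rV[R]_n) : \sum_j (\row_j r (delta_mx 0 j)) 0 j * x 0 j = r x.
  by rewrite rE; apply: eq_bigr => j _; rewrite mxE.
split => [x|]; rewrite sumE; first exact: le_trans (qp x).
apply: le_anti; rewrite (le_trans (rq h))//=.
have := rN h; have := rq (- h); lra.
Qed.

(** * Sequences *)

Section counting.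
Context (R : realType).
Local Notation cnt := (@counting nat R : {measure set nat -> \bar R}).
Local Notation N1 := pos_nat.

Lemma measurable_nat (D : set nat) (f : nat -> R) : measurable_fun D f.
Proof. by move=> _ Y _. Qed.

Lemma integral_range m n (f : nat -> R) : (forall k, 0 <= f k) ->
  (\int[cnt]_(k in [set k | m <= k < n]%N) (f k)%:E =
   (\sum_(m <= k < n) f k)%:E)%E.
Proof.
move=> f0; rewrite integral_mkcond ge0_integral_count; last first.
  by move=> k; rewrite patchE; case: ifP => // _; rewrite lee_fin.
have [nm|mn] := leqP n m.
  rewrite big_geq// eseries0// => k _ _.
  rewrite patchE memNset//= => /andP[mk kn].
  by have := leq_ltn_trans mk kn; rewrite ltnNge nm.
rewrite (@nneseries_split _ _ 0 n) ?add0n; last first.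
  by move=> k _; rewrite patchE; case: ifP => // _; rewrite lee_fin.
rewrite [X in (_ + X)%E]eseries0 ?adde0; last first.
  by move=> k nk _; rewrite patchE memNset//= => /andP[_]; rewrite ltnNge nk.
rewrite (big_cat_nat (n := m)) ?(ltnW mn)//= big_nat_cond big1 ?add0e;
  last first.
  move=> k /andP[/andP[_ km] _]; rewrite patchE memNset//= => /andP[].
  by rewrite leqNgt km.
rewrite -sumEFin big_nat_cond [RHS]big_nat_cond; apply: eq_bigr => k.
by move=> /andP[mkn _]; rewrite patchE mem_set.
Qed.

Lemma counting_range m n :
  cnt [set k | m <= k < n]%N = ((n - m)%:R)%:E.
Proof.
have := integral_range m n (fun=> @ler01 R).
rewrite (_ : (fun _ => _) = cst 1%E)// integral_cst// mul1e => ->.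
by rewrite big_const_nat iter_addr addr0 -[_ *+ _]mulr_natl mulr1.
Qed.

Let A n : set nat := [set k | 1 <= k < n.+1]%N.
Let v n : R := n%:R.
Let kappa n : int := Posz (trunc_log 2 n).

Lemma cesaro_seq_average (f : nat -> R) n : (forall k, 0 <= f k) ->
  cesaro_seq f n = average cnt A v f n.
Proof.
by move=> f0; rewrite /average integral_range// /cesaro_seq -EFinM mulrC.
Qed.

Lemma discrete_block k : block N1 kappa (Posz k) =
  [set n | 2 ^ k <= n < 2 ^ k.+1]%N.
Proof.
apply/seteqP; split=> n /=.
  by move=> [n0 [<-]]; exact: trunc_log_bounds.
move=> h; split; last by rewrite /= /kappa (trunc_log_eq (n := k)).
by case/andP: h => h _; apply: leq_trans h; rewrite expn_gt0.
Qed.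

Lemma discrete_block_measure k :
  cnt (block N1 kappa (Posz k)) = ((2 ^ k)%:R)%:E.
Proof.
by rewrite discrete_block counting_range expnS mul2n -addnn addnK.
Qed.

Lemma discrete_block_neg k : block N1 kappa (Negz k) = set0.
Proof. by apply/seteqP; split=> // n []. Qed.

Lemma discrete_frame : block_frame cnt N1 A v N1 kappa.
Proof.
split => //.
- by split => // x _ y /andP[].
- exact: (aeW cnt (fun x => id)).
- by move=> x; rewrite /v ltr0n.
- by move=> x y _ _ /andP[_]; rewrite ltnS lez_nat; exact: leq_trunc_log.
- move=> x y x0 y0; rewrite ltz_nat => xy; apply/andP; split => //.
  rewrite ltnS leqNgt; apply/negP => /ltnW/(leq_trunc_log 2).
  by rewrite leqNgt xy.
- case=> [k _|k]; last by rewrite discrete_block_neg measure0 ltxx.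
  by rewrite -PoszD addn1 discrete_block_measure lte_fin ltr0n expn_gt0.
- case=> k; last by rewrite discrete_block_neg measure0.
  by rewrite discrete_block_measure ltry.
Qed.

Lemma discrete_weight n : N1 n -> block_weight cnt v N1 kappa n <= 2.
Proof.
move=> n0; rewrite /block_weight discrete_block_measure/=.
rewrite ler_pdivrMr ?ltr0n ?expn_gt0// -natrM ler_nat -expnS.
by have /andP[_ /ltnW] := trunc_log_bounds (isT : 1 < 2)%N n0.
Qed.

(** On nonnegative sequences this is dominated by the formal adjoint of the
    dilation by three, which adds the terms of indices [3 n - 2], [3 n - 1]
    and [3 n]. *)
Definition triple (b : nat -> R) : nat -> R := fun n => b (3 * n)%N.

(** The weight is at most [2] and the block after that of [n] ends below [4
    n]; enlarging [4 n] to [9 n] leads to two applications of [triple]. *)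
Lemma discrete_majorant (X : fun_space nat R) :
  banach_ideal_space cnt N1 X -> bounded_on cnt N1 (@cesaro_seq R) X ->
  (exists2 M : R, 0 < M & forall b, X b -> (forall n, 0 <= b n) ->
     X (triple b) /\ fnorm X (triple b) <= M * fnorm X b) ->
  majorant_bounded cnt v N1 kappa X.
Proof.
move=> bX /(bounded_on_gt0 bX)[M M0 CX] [S S0 dilX].
exists (18 * (S * (S * M))).
  by rewrite (mulr_gt0 _ (mulr_gt0 S0 (mulr_gt0 S0 M0))).
move=> g Xg; pose h : nat -> R := fun x => `|g x|.
have [Xh nh] := bis_abs bX Xg.
have h0 n : 0 <= h n by exact: normr_ge0.
have [[_ XC] nC] := CX _ Xh.
set c := fine \o cesaro_seq h in XC nC.
have c0 n : 0 <= c n by rewrite /c /= divr_ge0// sumr_ge0.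
have [XD1 nD1] := dilX _ XC c0.
have [XD2 nD2] := dilX _ XD1 (fun n => c0 _).
exists (fun n => 18 * triple (triple c) n); split.
- exact: bis_scale bX _ _ XD2.
- rewrite (bis_normZ bX)// ger0_norm// -[leRHS]mulrA; apply: ler_wpM2l => //.
  apply: le_trans nD2 _; rewrite -[leRHS]mulrA.
  apply: ler_wpM2l; first exact: ltW.
  apply: le_trans nD1 _; rewrite -[leRHS]mulrA.
  apply: ler_wpM2l; first exact: ltW.
  by apply: le_trans nC _; apply: ler_wpM2l nh; exact: ltW.
apply: aeW => n n0.
have n0' : 0 < n%:R :> R by rewrite ltr0n.
rewrite [X in (_ <= X%:E)%E]ger0_norm;
  last exact: (mulr_ge0 (ler0n _ 18) (c0 _)).
have -> : triple (triple c) n = (\sum_(1 <= k < (9 * n).+1) h k) / (9 * n)%:R.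
  by rewrite /triple /c /= mulnA.
apply: (@le_trans _ _
    (n%:R^-1%:E * \int[cnt]_(k in A (9 * n)%N) (2 * h k)%:E)%E).
  apply: lee_wpmul2l; first by rewrite lee_fin invr_ge0.
  apply: (@le_trans _ _
      (\int[cnt]_(k in initial N1 kappa (kappa n + 1)%R) (2 * h k)%:E)%E).
    apply: ge0_le_integral => //.
      by move=> k [k0 _]; rewrite lee_fin (weighted_ge0 discrete_frame).
    by move=> k [k0 _]; rewrite lee_fin ler_wpM2r// discrete_weight.
  apply: ge0_subset_integral => //.
    by move=> k _; rewrite lee_fin mulr_ge0.
  move=> k [k0 /=]; rewrite -PoszD addn1 lez_nat => kn; rewrite /A /= k0 ltnS.
  have /andP[_ kl] := trunc_log_bounds (isT : 1 < 2)%N k0.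
  have /andP[nl _] := trunc_log_bounds (isT : 1 < 2)%N n0.
  apply: ltnW; apply: leq_trans kl _.
  apply: (@leq_trans (2 ^ (trunc_log 2 n).+2)); first by rewrite leq_exp2l.
  by rewrite !expnS mulnA leq_mul.
rewrite integral_range; last by move=> k; rewrite mulr_ge0.
rewrite -EFinM lee_fin -mulr_sumr natrM.
have -> : forall s : R, 18 * (s / (9 * n%:R)) = n%:R^-1 * (2 * s).
  by move=> s; field; rewrite gt_eqF.
exact: lexx.
Qed.

End counting.

(** * Boundedness by duality *)

Section kothe_duality.
Context (R : realType).
Local Notation cnt := (@counting nat R : {measure set nat -> \bar R}).
Local Notation N1 := pos_nat.

Lemma integral_pos_nat n (f : nat -> R) : (forall k, 0 <= f k) ->
  (forall k, (n <= k)%N -> f k = 0) ->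
  (\int[cnt]_(k in N1) (f k)%:E = (\sum_(1 <= k < n) f k)%:E)%E.
Proof.
move=> f0 fn; rewrite -integral_range// integral_mkcond [RHS]integral_mkcond.
congr (integral _ _ _); apply/funext => k; rewrite !patchE.
have [nk|kn] := leqP n k; first by rewrite fn//; do 2 case: ifP.
congr (if _ then _ else _); apply/idP/idP => /set_mem kN; apply/mem_set.
  by rewrite /= kn andbT.
by case/andP: kN.
Qed.

(** The indices are shifted by one because sequences start at [1]. *)
Definition extend n (x : 'rV[R]_n) (k : nat) : R :=
  \sum_j x 0 j * (k == j.+1)%:R.

Lemma extend_at n (x : 'rV[R]_n) (j : 'I_n) : extend x j.+1 = x 0 j.
Proof.
rewrite /extend (bigD1 j)//= eqxx mulr1 big1 ?addr0// => i ij.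
by rewrite eqSS eq_sym val_eqE (negPf ij) mulr0.
Qed.

Lemma extend_out n (x : 'rV[R]_n) k : (n < k)%N -> extend x k = 0.
Proof.
move=> nk; rewrite /extend big1// => j _.
by rewrite gtn_eqF ?mulr0// (leq_ltn_trans (ltn_ord j)).
Qed.

Lemma extendP n (x : 'rV[R]_n) (P : nat -> R -> Prop) :
  (forall j : 'I_n, P j.+1 (x 0 j)) ->
  (forall k, (n < k)%N -> P k 0) -> forall k, (0 < k)%N -> P k (extend x k).
Proof.
move=> Pj Pout [//|k] _; have [kn|nk] := ltnP k n.
  have := extend_at x (Ordinal kn); rewrite /= => ->.
  exact: (Pj (Ordinal kn)).
by rewrite extend_out//; exact: Pout.
Qed.

Variable X : fun_space nat R.
Hypothesis bX : banach_ideal_space cnt N1 X.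

Lemma extend_le n (x : 'rV[R]_n) (g : nat -> R) : X g ->
  (forall j : 'I_n, `|x 0 j| <= `|g j.+1|) ->
  X (extend x) /\ fnorm X (extend x) <= fnorm X g.
Proof.
move=> Xg xg; apply: (bis_ideal bX) => //.
apply: (aeW cnt) => k k0.
apply: (extendP (P := fun k a => `|a| <= `|g k|)) => //.
by move=> i _; rewrite normr0.
Qed.

Lemma extend_mem n (x : 'rV[R]_n) : X (extend x).
Proof.
have [e Xe e0] := bis_unit bX.
pose c := \sum_j `|x 0 j| / e j.+1.
have [] // := @extend_le _ x (fun k => c * e k).
  exact: bis_scale bX _ _ Xe.
move=> j; rewrite normrM (gtr0_norm (e0 _ _))// -ler_pdivrMr ?e0//.
have c0 i : 0 <= `|x 0 i| / e i.+1 by rewrite divr_ge0// ltW// e0.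
apply: le_trans (ler_norm _); rewrite /c (bigD1 j)//= lerDl.
by apply: sumr_ge0 => i _.
Qed.

Lemma sublinear_extend n : sublinear (fun x : 'rV[R]_n => fnorm X (extend x)).
Proof.
split=> [x y|t x t0].
  have -> : extend (x + y) = extend x \+ extend y.
    apply/funext => k; rewrite /extend /= -big_split/=.
    by apply: eq_bigr => j _; rewrite mxE mulrDl.
  by apply: bis_normD bX _ _ _ _; exact: extend_mem.
have -> : extend (t *: x) = (fun k => t * extend x k).
  apply/funext => k; rewrite /extend mulr_sumr.
  by apply: eq_bigr => j _; rewrite mxE mulrA.
by rewrite (bis_normZ bX) ?ger0_norm//; exact: extend_mem.
Qed.

Lemma sum_triple n (f : nat -> R) : (forall k, 0 <= f k) ->
  \sum_(j < n) f (3 * j.+1)%N <= \sum_(1 <= k < (3 * n).+1) f k.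
Proof.
move=> f0; elim: n => [|n IH]; first by rewrite big_ord0 big_geq.
rewrite big_ord_recr/= (_ : 3 * n.+1 = (3 * n).+3)%N; last by rewrite mulnS.
rewrite 3?big_nat_recr//=.
have := f0 (3 * n).+1; have := f0 (3 * n).+2; lra.
Qed.

Lemma kothe_functional_ge0 f : (0 <= kothe_functional cnt N1 X f)%E.
Proof.
apply: (@le_trans _ _ (\int[cnt]_(k in N1) (`|f k * cst 0 k|)%:E)%E).
  by apply: integral_ge0 => k _; rewrite lee_fin.
apply: ereal_sup_ubound; exists (cst 0) => //; split; first exact: bis_zero bX.
have := bis_normZ bX 0 (bis_zero bX); rewrite normr0 mul0r.
rewrite (_ : (fun _ => _) = cst 0); first by move=> ->.
by apply/funext => k; rewrite mul0r.
Qed.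

(** The functional that Hahn-Banach provides for the norm of [X] at [h] is,
    after taking absolute values, a member of the unit ball of [X'] because
    the norm of [X] is monotone. *)
Lemma extend_norming n (h : 'rV[R]_n) : (forall j, 0 <= h 0 j) ->
  exists U : nat -> R, [/\ forall k, 0 <= U k,
    (kothe_functional cnt N1 X U <= 1)%E &
    fnorm X (extend h) <= \sum_(j < n) U j.+1 * h 0 j].
Proof.
move=> h0; have [u [ule uh]] := hahn_banach_row h (sublinear_extend n).
pose U := extend (\row_j `|u 0 j|).
have UE (j : 'I_n) : U j.+1 = `|u 0 j| by rewrite /U extend_at mxE.
exists U; split.
- by move=> k; apply: sumr_ge0 => j _; rewrite mxE mulr_ge0.
- apply: ge_ereal_sup => _ [g [Xg ng] <-].
  rewrite (integral_pos_nat (n := n.+1))//; last first.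
    by move=> k nk; rewrite /U extend_out// mul0r normr0.
  rewrite lee_fin; apply: le_trans ng.
  rewrite big_add1/= big_mkord.
  pose x := \row_(j < n) (Num.sg (u 0 j) * `|g j.+1|).
  apply: (@le_trans _ _ (fnorm X (extend x))).
    apply: le_trans (ule x); rewrite le_eqVlt; apply/orP; left; apply/eqP.
    apply: eq_bigr => j _; rewrite UE mxE normrM normr_id [in LHS]normrEsg.
    by rewrite [in RHS]mulrA [u 0 j * _]mulrC.
  apply: (extend_le Xg _).2 => j; rewrite mxE normrM normr_id normr_sg.
  by case: (_ != 0); rewrite ?mul1r ?mul0r.
- rewrite -uh; apply: ler_sum => j _; rewrite UE.
  by apply: ler_wpM2r => //; exact: ler_norm.
Qed.

Lemma dilation3_triple (U : nat -> R) (j : nat) :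
  (fine \o dilation3_seq U) (3 * j.+1)%N = U j.+1.
Proof.
have E : ((3 * j.+1).-1 %/ 3)%N = j.
  have -> : ((3 * j.+1).-1 = j * 3 + 2)%N by lia.
  by rewrite divnMDl// addn0.
by rewrite /comp /dilation3_seq E.
Qed.

(** The norming sequence [U] for the truncation of [triple b] satisfies [U j =
    (sigma_3 U) (3 j)], so pairing it with [triple b] is part of pairing
    [sigma_3 U], which is in [X'], with [b]. *)
Lemma triple_extend_le (M : R) n (b : nat -> R) : 0 < M ->
  (forall U, kothe_dual cnt N1 X U ->
     kothe_dual cnt N1 X (fine \o dilation3_seq U) /\
     fnorm (kothe_dual cnt N1 X) (fine \o dilation3_seq U) <=
       M * fnorm (kothe_dual cnt N1 X) U) ->
  X b -> (forall k, 0 <= b k) ->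
  fnorm X (extend (\row_(j < n) b (3 * j.+1)%N)) <= M * fnorm X b.
Proof.
move=> M0 dil Xb b0; set h := \row_j _.
have h0 j : 0 <= h 0 j by rewrite mxE.
have [U [U0 U1 hU]] := extend_norming h0.
have ge0 := kothe_functional_ge0.
have DU : kothe_dual cnt N1 X U.
  by split; [exact: measurable_nat|rewrite (le_lt_trans U1)// ltry].
have [[_ Wfin] nW] := dil _ DU.
set W := fine \o dilation3_seq U in Wfin nW.
have WM : (kothe_functional cnt N1 X W <= M%:E)%E.
  rewrite -[leLHS]fineK ?ge0_fin_numE// lee_fin.
  apply: le_trans nW _; rewrite -[leRHS]mulr1.
  apply: ler_wpM2l; first exact: ltW.
  by rewrite -lee_fin fineK// ge0_fin_numE// (le_lt_trans U1)// ltry.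
(* [b] may have norm zero, hence the margin [e]. *)
apply/ler_addgt0Pr => e e0.
pose s := fnorm X b + e / M.
have nb := bis_norm_ge0 bX Xb.
have s0 : 0 < s by rewrite ltr_wpDl// divr_gt0.
have -> : M * fnorm X b + e = s * M by rewrite /s; field; rewrite gt_eqF.
pose g k := s^-1 * b k.
have Xg : X g by exact: bis_scale bX _ _ Xb.
have ng : fnorm X g <= 1.
  rewrite (bis_normZ bX)// gtr0_norm ?invr_gt0// ler_pdivrMl// mulr1 /s.
  by rewrite lerDl ltW// divr_gt0.
have Wg0 k : 0 <= W k * g k.
  rewrite mulr_ge0//; first by rewrite /W /=.
  by rewrite mulr_ge0// invr_ge0 ltW.
apply: le_trans hU _; rewrite -ler_pdivrMl//.
have : \sum_(1 <= k < (3 * n).+1) `|W k * g k| <= M.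
  rewrite -lee_fin -integral_range//.
  apply: le_trans WM.
  apply: (@le_trans _ _ (\int[cnt]_(k in N1) (`|W k * g k|)%:E)%E).
    by apply: ge0_subset_integral => // k /andP[].
  by apply: ereal_sup_ubound; exists g.
apply: le_trans; apply: le_trans (sum_triple n (fun k => normr_ge0 _)).
rewrite mulr_sumr; apply: ler_sum => j _.
by rewrite ger0_norm// /W dilation3_triple /g mxE mulrCA.
Qed.

(** The bound for truncations passes to [triple b] by the Fatou property. *)
Lemma triple_bounded : fatou_property cnt N1 X ->
  bounded_on cnt N1 (@dilation3_seq R) (kothe_dual cnt N1 X) ->
  exists2 M : R, 0 < M & forall b, X b -> (forall n, 0 <= b n) ->
    X (triple b) /\ fnorm X (triple b) <= M * fnorm X b.
Proof.
move=> fX [M0 dil0]; pose M := `|M0| + 1.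
have M_gt0 : 0 < M by rewrite ltr_wpDl.
have dil U : kothe_dual cnt N1 X U ->
    kothe_dual cnt N1 X (fine \o dilation3_seq U) /\
    fnorm (kothe_dual cnt N1 X) (fine \o dilation3_seq U) <=
      M * fnorm (kothe_dual cnt N1 X) U.
  move=> XU; have [[_ ?] h] := dil0 _ XU; split => //.
  apply: le_trans h _; apply: ler_wpM2r.
    by rewrite fine_ge0// kothe_functional_ge0.
  by rewrite (le_trans (ler_norm _))// lerDl.
exists M => // b Xb b0.
pose T n := extend (\row_(j < n) b (3 * j.+1)%N).
have TE n k : (0 < k)%N -> T n k = if (k <= n)%N then triple b k else 0.
  apply: (extendP (P := fun k a => a = if (k <= n)%N then triple b k else 0)).
    by move=> j; rewrite mxE ltn_ord.
  by move=> i ni; rewrite leqNgt ni.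
have nT n : fnorm X (T n) <= M * fnorm X b by exact: triple_extend_le.
have [||||Xt nd cv] := fX T (triple b).
- by move=> n; exact: extend_mem.
- exact: measurable_nat.
- apply: (aeW cnt) => k k0; split.
  + by rewrite TE// leqn0 gtn_eqF.
  + move=> m n mn; rewrite !TE//; case: (leqP k m) => [km|_].
      by rewrite (leq_trans km mn).
    by case: ifP => // _; exact: b0.
  + apply: cvg_near_cst; exists k => // n /= kn.
    by rewrite TE// kn.
- by exists (M * fnorm X b).
split => //; have <- := cvg_lim (@Rhausdorff R) cv.
apply: limr_le; first by apply/cvg_ex; exists (fnorm X (triple b)).
by near=> n; exact: nT.
Unshelve. all: by end_near. Qed.

End kothe_duality.

(** * The three cases *)

Lemma cesaro_space_congr d (T : measurableType d) (R : realType)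
    (mu : {measure set T -> \bar R}) (D : set T)
    (B B' : (T -> R) -> T -> \bar R) (X : fun_space T R) :
  (forall f : T -> R, B (fun x => `|f x|) = B' (fun x => `|f x|)) ->
  cesaro_space mu D B X = cesaro_space mu D B' X.
Proof.
move=> BB'; rewrite /cesaro_space; congr FunSpace; apply/funext => f /=.
  by rewrite /mkset BB'.
by rewrite BB'.
Qed.

Theorem theorem3 (R : realType) :
  (* (i) I = [0,+oo[ *)
  (let m : {measure set (measurableTypeR R) -> \bar R} := @lebesgue_measure R in
   let I := @half_line R in
   let C := @cesaro_op R in
   forall X0 X1 : fun_space R R,
   banach_ideal_space m I X0 -> banach_ideal_space m I X1 ->
   fatou_property m I X0 -> fatou_property m I X1 ->
   bounded_on m I C X0 -> bounded_on m I C X1 ->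
   (exists tau : R, [/\ 0 < tau < 1,
      bounded_on m I (dilation I tau) X0 &
      bounded_on m I (dilation I tau) X1]) ->
   forall phi : R -> R -> R, class_U phi ->
   space_eq (cl_space m I phi (cesaro_space m I C X0) (cesaro_space m I C X1))
            (cesaro_space m I C (cl_space m I phi X0 X1)))
  /\
  (* (ii) I = [0,1] *)
  (let m : {measure set (measurableTypeR R) -> \bar R} := @lebesgue_measure R in
   let I := @unit_interval R in
   let C := @cesaro_op R in
   forall X0 X1 : fun_space R R,
   banach_ideal_space m I X0 -> banach_ideal_space m I X1 ->
   fatou_property m I X0 -> fatou_property m I X1 ->
   bounded_on m I C X0 -> bounded_on m I C X1 ->
   symmetric_space m I X0 -> symmetric_space m I X1 ->
   bounded_on m I (cesaro_adj_op I) X0 -> bounded_on m I (cesaro_adj_op I) X1 ->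
   forall phi : R -> R -> R, class_U phi ->
   space_eq (cl_space m I phi (cesaro_space m I C X0) (cesaro_space m I C X1))
            (cesaro_space m I C (cl_space m I phi X0 X1)))
  /\
  (* (iii) I = {1, 2, 3, ...} *)
  (let m : {measure set nat -> \bar R} := @counting nat R in
   let I := pos_nat in
   let C := @cesaro_seq R in
   forall X0 X1 : fun_space nat R,
   banach_ideal_space m I X0 -> banach_ideal_space m I X1 ->
   fatou_property m I X0 -> fatou_property m I X1 ->
   bounded_on m I C X0 -> bounded_on m I C X1 ->
   bounded_on m I (@dilation3_seq R) (kothe_dual m I X0) ->
   bounded_on m I (@dilation3_seq R) (kothe_dual m I X1) ->
   forall phi : R -> R -> R, class_U phi ->
   space_eq (cl_space m I phi (cesaro_space m I C X0) (cesaro_space m I C X1))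
            (cesaro_space m I C (cl_space m I phi X0 X1))).
Proof.
split; [|split].
- move=> m I C X0 X1 b0 b1 _ _ C0 C1 [tau [tau01 dil0 dil1]] phi phiU.
  have q1 : 1 < tau^-1 by case/andP: tau01 => t0 t1; rewrite invf_gt1.
  apply: (calderon_average (real_block_frame (half_line_blocks q1))) => //.
  + exact: half_line_majorant.
  + exact: half_line_majorant.
- move=> m I C X0 X1 b0 b1 _ _ C0 C1 s0 s1 A0 A1 phi phiU.
  apply: (calderon_average (real_block_frame (logistic_blocks R))) => //.
  + exact: unit_interval_majorant.
  + exact: unit_interval_majorant.
- move=> m I C X0 X1 b0 b1 f0 f1 C0 C1 d0 d1 phi phiU.
  have E X : cesaro_space m I C X = cesaro_space m I (average m
      (fun n => [set k | 1 <= k < n.+1]%N) (fun n => n%:R)) X.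
    apply: cesaro_space_congr => f; apply/funext => n.
    by apply: cesaro_seq_average => k; exact: normr_ge0.
  rewrite !E; apply: (calderon_average (discrete_frame R)) => //.
  + by apply: discrete_majorant => //; exact: triple_bounded.
  + by apply: discrete_majorant => //; exact: triple_bounded.
Qed.
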